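(* Let $n\geq 2$ and let $g_n=(\varphi_{2n}\circ\varphi_{2n-1}\circ\cdots\circ\varphi_3)(x_0)\in\langle x_0,y_0,\dots,x_{2n},y_{2n}\rangle\leq\mathbf F_\infty$, where the homomorphisms $\varphi_k$ are those defined in the context. Then $$n^2-n+1\leq\|g_n\|\leq 4n^2-8n+5,$$ $$2n\leq\|g_n^2\|\leq 8n-4.$$
   Context: Let $\mathbb N=\{0,1,2,\dots\}$, $S=\{x_i,y_i\mid i\in\mathbb N\}$ and let $\mathbf F_\infty$ be the free group freely generated by $S$; $s_i$ denotes either $x_i$ or $y_i$ (a generator of index $i$). For $g\in\mathbf F_\infty$, $\|g\|$ is the smallest $m\ge0$ such that $g$ is a product of $m$ conjugates of elements of $S\cup S^{-1}$. Fix an integer $n\ge2$. For $k\ge1$ let $T_k=(x_ky_k)^n(x_k^{-1}y_k^{-1})^n$, and let $\varphi_k\colon\mathbf F_\infty\to\mathbf F_\infty$ be the homomorphism with $\varphi_k(s_i)=s_iT_k$ if $i$ or $k$ is even, and $\varphi_k(s_i)=T_k^{-1}s_i$ if both $i$ and $k$ are odd. *)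

(* Defs.v *)
From HB Require Import structures.
From mathcomp Require Import all_boot.
From mathcomp Require Import boolp.

Set Implicit Arguments.
Unset Strict Implicit.
Unset Printing Implicit Defensive.

Import Algebra.
Local Open Scope group_scope.

(* The free group on an alphabet T, realised by reduced words. A letter is a  *)
(* pair (b, t) standing for t if b = false and for t^-1 if b = true.          *)
Section FreeGroup.
Variable T : choiceType.

Local Notation letter := (bool * T)%type.

Definition letter_inv (l : letter) : letter := (~~ l.1, l.2).

Lemma letter_invK : involutive letter_inv.
Proof. by case=> b t; rewrite /letter_inv /= negbK. Qed.

Definition reduced (w : seq letter) : bool :=
  sorted (fun l l' => l' != letter_inv l) w.

Definition push (l : letter) (w : seq letter) : seq letter :=
  if w is l' :: w' then if l' == letter_inv l then w' else l :: w
  else [:: l].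

Definition reduce (w : seq letter) : seq letter := foldr push [::] w.

Lemma push_reduced l w : reduced w -> reduced (push l w).
Proof.
case: w => [|l' w] //= rw; case: eqP => [_|/eqP ne]; first exact: path_sorted rw.
by rewrite /= ne.
Qed.

Lemma foldr_push_reduced u w : reduced w -> reduced (foldr push w u).
Proof. by move=> rw; elim: u => //= l u; apply: push_reduced. Qed.

Lemma reduce_reduced w : reduced (reduce w).
Proof. exact: foldr_push_reduced. Qed.

Lemma reduce_id w : reduced w -> reduce w = w.
Proof.
elim: w => //= l w IHw rw; rewrite -/(reduce w) IHw; last exact: path_sorted rw.
by case: w rw {IHw} => //= l' w /andP[/negPf-> _].
Qed.

Lemma pushK l w : reduced w -> push l (push (letter_inv l) w) = w.
Proof.
case: w => [|l' w] /= rw; first by rewrite eqxx.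
rewrite letter_invK; case: eqP rw => [->|_] rw /=; last by rewrite eqxx.
by case: w rw => //= k w /andP[/negPf-> _].
Qed.

Lemma foldr_push_reduce u w :
  reduced w -> foldr push w (reduce u) = foldr push w u.
Proof.
move=> rw; elim: u => //= l u <-; rewrite -/(reduce u).
have := reduce_reduced u; case: (reduce u) => //= l' v rv.
case: eqP => [->|] //=; rewrite pushK //; exact: foldr_push_reduced.
Qed.

Lemma reduce_cat u v : reduce (u ++ v) = foldr push (reduce v) u.
Proof. by rewrite /reduce foldr_cat. Qed.

Lemma reduce_catl u v : reduce (reduce u ++ v) = reduce (u ++ v).
Proof. by rewrite !reduce_cat foldr_push_reduce // reduce_reduced. Qed.

Lemma reduce_catr u v : reduce (u ++ reduce v) = reduce (u ++ v).
Proof. by rewrite !reduce_cat (reduce_id (reduce_reduced v)). Qed.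

Definition word_inv (w : seq letter) : seq letter := rev (map letter_inv w).

Lemma word_invK : involutive word_inv.
Proof.
by move=> w; rewrite /word_inv map_rev revK -map_comp -[RHS]map_id;
  apply: eq_map => l /=; rewrite letter_invK.
Qed.

Lemma word_inv_reduced w : reduced w -> reduced (word_inv w).
Proof.
rewrite /reduced /word_inv rev_sorted sorted_map; apply: sub_sorted => l l'.
by rewrite /= letter_invK eq_sym.
Qed.

Lemma reduce_catV w : reduce (w ++ word_inv w) = [::].
Proof.
elim: w => //= l w IHw; rewrite -/(reduce _) /word_inv /= rev_cons -cats1 catA.
by rewrite -reduce_catl IHw /= eqxx.
Qed.

Definition free_group : Type := {w : seq letter | reduced w}.
HB.instance Definition _ := SubChoice.on free_group.

Definition free_one : free_group := Sub [::] isT.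
Definition free_mul (u v : free_group) : free_group :=
  Sub (reduce (val u ++ val v)) (reduce_reduced _).
Definition free_inv (u : free_group) : free_group :=
  Sub (word_inv (val u)) (word_inv_reduced (valP u)).

Lemma free_mulA : associative free_mul.
Proof.
by move=> u v w; apply: val_inj; rewrite /= reduce_catl reduce_catr catA.
Qed.

Lemma free_mul1 : left_id free_one free_mul.
Proof. by move=> u; apply: val_inj; rewrite /= reduce_id ?(valP u). Qed.

Lemma free_mulr1 : right_id free_one free_mul.
Proof. by move=> u; apply: val_inj; rewrite /= cats0 reduce_id ?(valP u). Qed.

Lemma free_mulrV : right_inverse free_one free_inv free_mul.
Proof. by move=> u; apply: val_inj; rewrite /= reduce_catV. Qed.

Lemma free_mulV : left_inverse free_one free_inv free_mul.
Proof.
move=> u; apply: val_inj => /=.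
by rewrite -{2}(word_invK (val u)) reduce_catV.
Qed.

HB.instance Definition _ := isGroup.Build free_group
  free_mulA free_mul1 free_mulr1 free_mulV free_mulrV.

Definition free_gen (t : T) : free_group := Sub [:: (false, t)] isT.

Definition free_letter (l : letter) : free_group :=
  if l.1 then (free_gen l.2)^-1 else free_gen l.2.

Lemma free_letterE (u : free_group) :
  u = \prod_(l <- val u) free_letter l.
Proof.
case: u => w rw /=; apply: val_inj => /=; elim: w rw => [|l w IHw] rw.
  by rewrite big_nil.
rewrite big_cons /= -IHw; last exact: path_sorted rw.
have -> : val (free_letter l) = [:: l] by case: l {rw} => [[] t].
by rewrite cat1s reduce_id.
Qed.

(* The homomorphism from the free group extending f : T -> H. *)
Section Extension.
Variables (H : groupType) (f : T -> H).

Definition free_ext_letter (l : letter) : H := if l.1 then (f l.2)^-1 else f l.2.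

Definition free_ext (u : free_group) : H :=
  \prod_(l <- val u) free_ext_letter l.

Lemma free_ext_reduce w :
  \prod_(l <- reduce w) free_ext_letter l = \prod_(l <- w) free_ext_letter l.
Proof.
elim: w => //= l w IHw; rewrite -/(reduce w) big_cons -{}IHw.
case: (reduce w) => [|l' v] /=; first by rewrite big_seq1 big_nil mulg1.
case: eqP => [->|_]; rewrite !big_cons // mulgA.
by case: l => [[] t]; rewrite /free_ext_letter /= (mulVg, mulgV) mul1g.
Qed.

Lemma free_extM : {morph free_ext : u v / u * v}.
Proof. by move=> u v; rewrite /free_ext free_ext_reduce big_cat. Qed.

Lemma free_ext1 : free_ext 1 = 1.
Proof. exact: big_nil. Qed.

HB.instance Definition _ :=
  isUMagmaMorphism.Build free_group H free_ext (conj free_ext1 free_extM).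

Lemma free_ext_gen t : free_ext (free_gen t) = f t.
Proof. exact: big_seq1. Qed.

Lemma free_ext_unique (h : UMagmaMorphism.type free_group H) :
  (forall t, h (free_gen t) = f t) -> h =1 free_ext.
Proof.
move=> hf u; rewrite [u in LHS]free_letterE (big_morph h (@gmulfM _ _ h) (@gmulf1 _ _ h)).
by apply: eq_bigr => -[[] t] _; rewrite /free_letter /= ?gmulfV hf.
Qed.

End Extension.

Definition is_conj_product (g : free_group) (m : nat) : Prop :=
  exists s : seq (letter * free_group),
    size s = m /\ g = \prod_(p <- s) free_letter p.1 ^ p.2.

Lemma ex_conj_product (g : free_group) : exists m, `[< is_conj_product g m >].
Proof.
exists (size (val g)); apply/asboolP.
exists [seq (l, 1) | l <- val g]; rewrite size_map big_map; split=> //.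
by rewrite [LHS]free_letterE; apply: eq_bigr => l _; rewrite conjg1.
Qed.

Definition conj_norm (g : free_group) : nat := ex_minn (ex_conj_product g).

End FreeGroup.

(* Membership in the subgroup generated by A. *)
Definition generated (G : groupType) (A : {pred G}) (g : G) : Prop :=
  forall H : {pred G}, group_closed H -> {subset A <= H} -> g \in H.

(* The generators of index i are x_i = (i, false) and y_i = (i, true). *)
Definition F_infty : groupType := free_group (nat * bool)%type.

Definition x_ (i : nat) : F_infty := free_gen (i, false).
Definition y_ (i : nat) : F_infty := free_gen (i, true).

Definition T_ (n k : nat) : F_infty :=
  (x_ k * y_ k) ^+ n * ((x_ k)^-1 * (y_ k)^-1) ^+ n.

Definition phi_gen (n k : nat) (s : nat * bool) : F_infty :=
  if ~~ odd s.1 || ~~ odd k then free_gen s * T_ n k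
  else (T_ n k)^-1 * free_gen s.

Definition phi (n k : nat) : F_infty -> F_infty := free_ext (phi_gen n k).
HB.instance Definition _ n k := UMagmaMorphism.copy (phi n k) (free_ext (phi_gen n k)).

(* foldl applies phi_3 first and phi_(2n) last. *)
Definition g_ (n : nat) : F_infty :=
  foldl (fun g k => phi n k g) (x_ 0) (index_iota 3 (2 * n).+1).

Definition gens_upto (m : nat) : seq F_infty :=
  [seq x_ i | i <- iota 0 m.+1] ++ [seq y_ i | i <- iota 0 m.+1].

(* Main.v *)
Require Import Defs.
From mathcomp Require Import all_boot.
From mathcomp Require Import boolp ssralg ssrnum ssrint zify ring.

(** Let [c = O^-1 E], where the composite of the last [m] homomorphisms
    maps a generator [s] of even index to [s V] and one of odd index to
    [O^-1 s E].  Composing with one more homomorphism, of level [j], multiplies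
    these factors by a twist [tau = twist n p q = (pq)^n (p^-1 q^-1)^n]:
    - for even [j], [tau] is the twist of [x_j V] and [y_j V], and [(V, c)]
      becomes [(V tau, c tau)];
    - for odd [j], [tau] is, up to conjugating the two letters by [O], the twist
      of [x_j c] and [y_j c], and [(V, c)] becomes [(V tau, tau^-1 c)].
    Finally [g_n = x_0 V] for the [V] obtained after [2n-2] levels.  So both pairs
    of bounds are statements about the words in [V] and [c].

    Upper bounds.  A twist is a commutator [p w p^-1 w^-1], and also
    [v q v^-1 q^-1]; deleting the letter [x_j] of [p] and of [p^-1] replaces them
    by [c^+-1] (or [V^+-1]), at the cost of two letters.  In a product
    [tau g tau h] one can so choose four deletions that what is left is a
    conjugate of [g c] times a conjugate of [c^-1 h] ([twist_pair_left]).  Hence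
    [c^-1 V] and [V c] cost at most four more letters every second level,
    which makes the norm of [V^2] linear.  The norm of [V] itself is bounded at
    an odd level by those of [c] and [c^-1 V], and that of [c] at the even level
    above by those of [V] and [V c], which makes it quadratic
    ([tower_upper]).

    Lower bounds.  If a product of [m] conjugates of letters is spelled by a
    word, then deleting at most [m] letters of the word makes it trivial
    ([conj_norm_deletion]).  The letters of one level that survive the deletion
    cancel in nested pairs, and these cut the word into regions that are words
    in the next [V] and [c], each of which must be trivialized separately
    ([splits_of_norm]).  The exponent sums of [V] and [c] are additive over the
    regions.  Call a word good if its total exponent sum is odd, so that some
    region of a good word is good.  Consider an odd level, where
    [c] is the factor attached to the letters, and a good word with even exponent
    in [c].  If [c] has even exponent in every region, then map [c] to a
    reflection of the integers, [V] to the identity, and the two letters to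
    opposite unit translations: the regions become trivial, the twist becomes
    the translation by [4n] and the word displaces 0 by an odd multiple of
    [4n], so that at least [4n] letters of the level were deleted
    ([splits_ge4n]).  Otherwise a region other than the good one has nonzero
    exponents, and at each higher pair of levels it loses two letters of its own
    ([nontrivial_lower]).  At an even level the roles of [V] and [c] are
    exchanged.  Therefore the [a+1]-st pair of levels, counted from the top, adds
    at least [2a+2] to the norm of a good word ([good_lower]), and [V] is good.
    The words [V] in [g_n ^+ 2] have total exponent 2, which
    only provides a region with nonzero exponents, whence the linear bound. *)

Set Implicit Arguments.
Unset Strict Implicit.
Unset Printing Implicit Defensive.

Import Algebra.
Local Open Scope group_scope.

(** * Words, deletions and the conjugation norm *)

Section Words.
Variable T : choiceType.
Local Notation letter := (bool * T)%type.
Implicit Types (u v w : seq letter) (g h : free_group T) (l : letter).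

Definition of_word w : free_group T := Sub (reduce w) (reduce_reduced w).

Lemma of_word_cat u v : of_word (u ++ v) = of_word u * of_word v.
Proof. by apply: val_inj; rewrite /= reduce_catl reduce_catr. Qed.

Lemma of_word_val g : of_word (val g) = g.
Proof. by apply: val_inj; rewrite /= reduce_id ?(valP g). Qed.

Lemma of_word_nil : of_word [::] = 1.
Proof. exact: val_inj. Qed.

Lemma of_word1 l : of_word [:: l] = free_letter l.
Proof. by apply: val_inj; case: l => [[] t]. Qed.

Lemma of_word_cons l w : of_word (l :: w) = free_letter l * of_word w.
Proof. by rewrite -cat1s of_word_cat of_word1. Qed.

Lemma free_letter_inv l : free_letter (letter_inv l) = (free_letter l)^-1.
Proof. by case: l => [[] t]; rewrite /free_letter /= ?invgK. Qed.

Lemma of_word_eq1 w : (of_word w == 1) = (reduce w == [::]).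
Proof. by []. Qed.

Lemma reduce_nil_rot u v : (reduce (u ++ v) == [::]) = (reduce (v ++ u) == [::]).
Proof.
rewrite -!of_word_eq1 !of_word_cat !mulg_eq1.
by rewrite -[in RHS]eqg_inv invgK eq_sym.
Qed.

Lemma reduce_nil_mid u v w : reduce v == [::] ->
  (reduce (u ++ v ++ w) == [::]) = (reduce (u ++ w) == [::]).
Proof. by rewrite -!of_word_eq1 !of_word_cat => /eqP->; rewrite mul1g. Qed.

(** The first letter of the reduced form is an actual letter of the word: what
    precedes it cancels out. *)
Lemma reduce_head l w t : reduce w = l :: t ->
  exists w1 w2, [/\ w = w1 ++ l :: w2, reduce w1 = [::] & reduce w2 = t].
Proof.
have [m] := ubnP (size w); elim: m w l t => // m IHm [|k w] l t //= ltm.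
rewrite -/(reduce w); case Ew: (reduce w) => [|k' s] /=.
  by case=> <- <-; exists [::], w.
case: eqP => [k'E|_] sE; last first.
  by case: sE => <- <-; exists [::], w.
have [w1 [w2 [wE w1E w2E]]] := IHm w k' s ltm Ew.
have [|w3 [w4 [w2E' w3E w4E]]] := IHm w2 l t _ (etrans w2E sE).
  by move: ltm; rewrite wE size_cat /=; lia.
exists (k :: w1 ++ k' :: w3), w4; split=> //.
  by rewrite wE w2E' /= -catA.
apply/eqP; rewrite -of_word_eq1 of_word_cons of_word_cat of_word_cons k'E.
move/eqP: w1E; move/eqP: w3E; rewrite -!of_word_eq1 => /eqP-> /eqP->.
by rewrite free_letter_inv mul1g mulg1 mulgV.
Qed.

Lemma reduce_partner l w : reduce (l :: w) = [::] ->
  exists w1 w2, [/\ w = w1 ++ letter_inv l :: w2, reduce w1 = [::]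
                  & reduce w2 = [::]].
Proof.
rewrite /= -/(reduce w); case Ew: (reduce w) => [|k t] //=.
by case: eqP => // kE tE; apply: reduce_head; rewrite Ew kE tE.
Qed.

(** A letter inserted in a word makes it trivial only by cancelling against one
    letter of the word, so that deleting this partner has the same effect. *)
Lemma reduce_delete u l v : reduce (u ++ l :: v) = [::] ->
  exists w, [/\ subseq w (u ++ v), reduce w = [::]
              & size (u ++ v) = (size w).+1].
Proof.
move/eqP; rewrite reduce_nil_rot cat_cons => /eqP/reduce_partner.
case=> w1 [w2 [E w1E w2E]].
have w12: reduce (w1 ++ w2) == [::].
  by rewrite -of_word_eq1 of_word_cat mulg_eq1 -eqg_inv;
     move/eqP: w1E; move/eqP: w2E; rewrite -!of_word_eq1 => /eqP-> /eqP->;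
     rewrite invg1.
have [le_v|lt_v] := leqP (size v) (size w1).
  (* the partner of l lies in u *)
  have vE: v = take (size v) w1.
    have := congr1 (take (size v)) E.
    by rewrite take_size_cat // takel_cat.
  have w1v: w1 = v ++ drop (size v) w1 by rewrite {1}vE cat_take_drop.
  exists (drop (size v) w1 ++ w2 ++ v); split.
  - have uE: u = drop (size v) w1 ++ letter_inv l :: w2.
      by move/eqP: E; rewrite {1}w1v -catA eqseq_cat // eqxx => /eqP.
    rewrite uE -catA subseq_cat2l /=.
    exact: (suffix_subseq [:: letter_inv l] (w2 ++ v)).
  - by apply/eqP; rewrite catA reduce_nil_rot catA -w1v.
  - move/(congr1 size): E; rewrite {1}w1v !size_cat /=; lia.
(* the partner of l lies in v *)
have [v2 vE]: exists v2, v = w1 ++ letter_inv l :: v2.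
  exists (drop (size w1).+1 v).
  have: take (size w1).+1 (v ++ u) = rcons w1 (letter_inv l).
    by rewrite E -cat_rcons take_size_cat // size_rcons.
  rewrite takel_cat // -cat_rcons => <-; by rewrite cat_take_drop.
have w2E': w2 = v2 ++ u.
  by move: E; rewrite vE -catA => /eqP; rewrite eqseq_cat // eqxx /= eqseq_cons
    eqxx => /eqP.
exists (u ++ w1 ++ v2); split.
- rewrite vE subseq_cat2l subseq_cat2l.
  exact: (suffix_subseq [:: letter_inv l] v2).
- by apply/eqP; rewrite reduce_nil_rot -catA -w2E'.
- by rewrite vE !size_cat /=; lia.
Qed.

Definition trivializable w m :=
  exists u, [/\ subseq u w, reduce u = [::] & size w <= size u + m].

Lemma subseq_cat_split (S : eqType) (u v w : seq S) : subseq u (v ++ w) ->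
  exists s1 s2, [/\ u = s1 ++ s2, subseq s1 v & subseq s2 w].
Proof.
case/subseqP=> m; rewrite size_cat => sm ->.
exists (mask (take (size v) m) v), (mask (drop (size v) m) w).
rewrite !mask_subseq -mask_cat ?cat_take_drop //.
by rewrite size_takel // sm leq_addr.
Qed.

(** Keeping only one letter of a cancelling pair amounts, once the pair is gone,
    to inserting a letter; [reduce_delete] trades it for a deletion. *)
Lemma trivializable_cancel u l v m :
  trivializable (u ++ l :: letter_inv l :: v) m -> trivializable (u ++ v) m.
Proof.
case=> w [sw rw].
have {sw}[w1 [w' [wE s1 sw']]] := subseq_cat_split sw; subst w.
have := @subseq_cat_split _ w' [:: l; letter_inv l] v sw'.
case=> s [w2 [w'E ss s2]]; subst w'.
rewrite !size_cat /= => szw.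
have []: [\/ s = [::], s = [:: l], s = [:: letter_inv l]
            | s = [:: l; letter_inv l]].
- case/subseqP: ss => -[|[] [|[] [|? ?]]] //= _ ->;
    by [constructor 1 | constructor 2 | constructor 3 | constructor 4].
- move=> sE; exists (w1 ++ w2); rewrite cat_subseq //; split=> //.
    by rewrite sE in rw.
  by move: szw; rewrite sE /= !size_cat; lia.
- move=> sE; rewrite sE in rw szw.
  have [w [sw wE szE]] := reduce_delete rw.
  exists w; split=> //; first exact: subseq_trans sw (cat_subseq s1 s2).
  by move: szE szw; rewrite !size_cat /=; lia.
- move=> sE; rewrite sE in rw szw.
  have [w [sw wE szE]] := reduce_delete rw.
  exists w; split=> //; first exact: subseq_trans sw (cat_subseq s1 s2).
  by move: szE szw; rewrite !size_cat /=; lia.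
- move=> sE; exists (w1 ++ w2); rewrite cat_subseq //; split=> //.
    apply/eqP; rewrite -(@reduce_nil_mid w1 s w2) ?rw // sE.
    by rewrite -of_word_eq1 !of_word_cons of_word_nil mulg1 free_letter_inv mulgV.
  by move: szw; rewrite sE /= !size_cat /=; lia.
Qed.

Lemma trivializable_insert u l v m :
  trivializable (u ++ v) m -> trivializable (u ++ l :: letter_inv l :: v) m.
Proof.
case=> w [/subseq_cat_split[w1 [w2 [-> s1 s2]]] rw sz].
exists (w1 ++ l :: letter_inv l :: w2); split.
- by rewrite cat_subseq //= !eqxx.
- apply/eqP; rewrite (@reduce_nil_mid w1 [:: l; letter_inv l] w2) ?rw //.
  by rewrite /= eqxx.
- by move: sz; rewrite !size_cat /=; lia.
Qed.

Lemma trivializable_reduce u w m :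
  trivializable (u ++ w) m -> trivializable (u ++ reduce w) m.
Proof.
elim: w u => //= l w IHw u; rewrite -cat_rcons => /IHw; rewrite cat_rcons.
rewrite -/(reduce w); case: (reduce w) => [|k v] //=; case: eqP => // ->.
exact: trivializable_cancel.
Qed.

Lemma trivializable_unreduce u w m :
  trivializable (u ++ reduce w) m -> trivializable (u ++ w) m.
Proof.
elim: w u => //= l w IHw u H; rewrite -cat_rcons; apply: IHw; rewrite cat_rcons.
move: H; rewrite -/(reduce w); case: (reduce w) => [|k v] //=.
case: eqP => // ->; exact: trivializable_insert.
Qed.

(** In the word that spells a product of conjugates [h^-1 l h], deleting the
    middle letters [l] is enough; the number of deletions needed does not depend
    on the word that represents the element. *)
Lemma conj_product_trivializable w m :
  is_conj_product (of_word w) m -> trivializable w m.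
Proof.
case=> s [<- E].
pose W := flatten [seq word_inv (val p.2) ++ p.1 :: val p.2 | p <- s].
have of_word_inv v : of_word (word_inv v) = (of_word v)^-1.
  apply/eqP; rewrite -[_ == _^-1]mulg_eq1 -of_word_cat of_word_eq1.
  by rewrite -{2}(word_invK v) reduce_catV.
have WE: of_word W = of_word w.
  rewrite E /W; elim: s {E W} => [|p s IHs]; first by rewrite big_nil of_word_nil.
  rewrite big_cons /= of_word_cat IHs of_word_cat of_word_cons of_word_inv.
  by rewrite of_word_val.
apply: (@trivializable_unreduce [::]) => /=.
rewrite -[reduce w]/(val (of_word w)) -WE.
apply: (@trivializable_reduce [::]) => /=.
exists (flatten [seq word_inv (val p.2) ++ val p.2 | p <- s]); split.
- rewrite /W; elim: s {E W WE} => //= p s IHs.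
  by rewrite cat_subseq ?IHs // cat_subseq // subseq_cons.
- apply/eqP; rewrite -of_word_eq1; elim: s {E W WE} => //= p s IHs.
  by rewrite of_word_cat (eqP IHs) mulg1 of_word_cat of_word_inv mulVg.
- rewrite /W; elim: s {E W WE} => //= p s IHs.
  by move: IHs; rewrite !size_cat /=; lia.
Qed.

Lemma conj_normP g : is_conj_product g (conj_norm g).
Proof. by rewrite /conj_norm; case: ex_minnP => m /asboolP. Qed.

Lemma conj_norm_le g m : is_conj_product g m -> conj_norm g <= m.
Proof.
by move=> gm; rewrite /conj_norm; case: ex_minnP => k _; apply; apply/asboolP.
Qed.

Lemma conj_norm_deletion w : trivializable w (conj_norm (of_word w)).
Proof. exact/conj_product_trivializable/conj_normP. Qed.

Lemma conj_norm1 : conj_norm (1 : free_group T) = 0%N.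
Proof.
apply/eqP; rewrite -leqn0; apply: conj_norm_le; exists [::].
by rewrite big_nil.
Qed.

Lemma conj_normM g h : conj_norm (g * h) <= conj_norm g + conj_norm h.
Proof.
have [s [sz gE]] := conj_normP g; have [t [tz hE]] := conj_normP h.
apply: conj_norm_le; exists (s ++ t).
by rewrite size_cat sz tz big_cat -gE -hE.
Qed.

Lemma conj_normJ_le g h : conj_norm (g ^ h) <= conj_norm g.
Proof.
have [s [sz gE]] := conj_normP g.
apply: conj_norm_le; exists [seq (p.1, p.2 * h) | p <- s].
rewrite size_map big_map; split=> //.
by rewrite {1}gE conjg_prod; apply: eq_bigr => p _; rewrite conjgM.
Qed.

Lemma conj_normJ g h : conj_norm (g ^ h) = conj_norm g.
Proof.
apply/eqP; rewrite eqn_leq conj_normJ_le /=.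
by rewrite -{1}(conjgK h g) conj_normJ_le.
Qed.

Lemma conj_normC g h : conj_norm (g * h) = conj_norm (h * g).
Proof. by rewrite -(conj_normJ (g * h) g) conjgE mulgA mulKg. Qed.

Lemma conj_normV g : conj_norm g^-1 = conj_norm g.
Proof.
suff le (h0 : free_group T) : conj_norm h0^-1 <= conj_norm h0.
  by apply/eqP; rewrite eqn_leq le -{1}(invgK g) le.
have [s [sz hE]] := conj_normP h0.
apply: conj_norm_le; exists (rev [seq (letter_inv p.1, p.2) | p <- s]).
rewrite size_rev size_map; split=> //; rewrite [in LHS]hE {hE sz}.
elim: s => [|p s IHs]; first by rewrite !big_nil invg1.
rewrite big_cons invgM IHs /= rev_cons -cats1 big_cat big_seq1 /=.
by rewrite free_letter_inv conjVg.
Qed.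

Lemma conj_norm_letter l : conj_norm (free_letter l) <= 1.
Proof.
by apply: conj_norm_le; exists [:: (l, 1)]; rewrite big_seq1 conjg1.
Qed.

Lemma conj_norm_gen t : conj_norm (free_gen t : free_group T) <= 1.
Proof. exact: (conj_norm_letter (false, t)). Qed.

(** Deleting one letter multiplies the element by one conjugate of a letter. *)
Lemma conj_norm_subseq u w : subseq u w ->
  conj_norm (of_word w * (of_word u)^-1) <= size w - size u.
Proof.
elim: w u => [|l w IHw] [|k u] // sub; first by rewrite of_word_nil mulgV conj_norm1.
  rewrite of_word_nil invg1 mulg1 of_word_cons /=.
  apply: leq_trans (conj_normM _ _) _.
  have := IHw [::] (sub0seq w); rewrite of_word_nil invg1 mulg1 /=.
  by have := conj_norm_letter l; lia.
move: sub => /=; case: eqP => [-> sub|_ sub].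
  rewrite !of_word_cons invgM conj_normC -mulgA mulKg conj_normC.
  exact: IHw.
have := size_subseq sub => /= sz.
have le := IHw _ sub; rewrite (of_word_cons l) -mulgA.
apply: leq_trans (conj_normM _ _) _.
by rewrite /= subSn // -add1n leq_add ?conj_norm_letter.
Qed.

End Words.

(** * Splitting a word along the letters of one level *)

(** Words over [x], [y], [V] and [c]: a symbol [(b, (true, i))] is [x] or [y], and
    a symbol [(b, (false, i))] is [V] or [c], for [i] equal to [false] or [true];
    it is inverted when [b] holds. *)
Notation symbol := (bool * (bool * bool))%type.

Local Notation spelling := (seq (bool * (nat * bool))).

Definition is_xy (l : symbol) : bool := l.2.1.

Section Eval.
Variables (G : groupType) (f : bool * bool -> G).

Definition eval (w : seq symbol) : G := \prod_(l <- w) free_ext_letter f l.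

Lemma eval_cat u v : eval (u ++ v) = eval u * eval v.
Proof. exact: big_cat. Qed.

Lemma eval_cons l v : eval (l :: v) = free_ext_letter f l * eval v.
Proof. exact: big_cons. Qed.

Lemma eval_nil : eval [::] = 1.
Proof. exact: big_nil. Qed.

Lemma free_ext_letterV l :
  free_ext_letter f (letter_inv l) = (free_ext_letter f l)^-1.
Proof. by case: l => [[] t]; rewrite /free_ext_letter /= ?invgK. Qed.

Lemma eval_inv w : eval (word_inv w) = (eval w)^-1.
Proof.
elim: w => [|l w IHw]; first by rewrite eval_nil invg1.
rewrite /word_inv /= rev_cons -cats1 eval_cat -/(word_inv w) IHw.
by rewrite !eval_cons eval_nil mulg1 invgM free_ext_letterV.
Qed.

Lemma eval_pow w n : eval (flatten (nseq n w)) = eval w ^+ n.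
Proof. by elim: n => [|n IHn] /=; rewrite ?eval_nil // eval_cat IHn expgS. Qed.

End Eval.

(** The planar picture of a trivialization, in which [d] of the letters [x] and
    [y] are deleted and the others cancel in nested pairs.  The arcs that join
    the pairs cut the disc into regions, and each region reads a word in [V]
    and [c] along its boundary. *)
Inductive splits : seq symbol -> nat -> seq (seq symbol) -> Prop :=
| splits_region w : all (predC is_xy) w -> splits w 0 [:: w]
| splits_delete a w1 w2 d rs : is_xy a ->
    splits (w1 ++ w2) d rs -> splits (w1 ++ a :: w2) d.+1 rs
| splits_match a w1 w2 w3 d e rs ss : is_xy a ->
    splits w2 d rs -> splits (w1 ++ w3) e ss ->
    splits (w1 ++ a :: w2 ++ letter_inv a :: w3) (d + e) (rs ++ ss).

Definition avoids (j : nat) (g : F_infty) : bool :=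
  all (fun l : bool * (nat * bool) => l.2.1 != j) (val g).

Section Regions.
Variables (j : nat) (V c : F_infty).
Hypotheses (avV : avoids j V) (avc : avoids j c).

Definition assign (t : bool * bool) : F_infty :=
  if t.1 then free_gen (j, t.2) else if t.2 then c else V.

Definition spell (l : symbol) : spelling :=
  if is_xy l then [:: (l.1, (j, l.2.2))] else val (free_ext_letter assign l).

Lemma of_word_spell w : of_word (flatten (map spell w)) = eval assign w.
Proof.
elim: w => [|l w IHw]; first by rewrite /eval big_nil of_word_nil.
rewrite /= of_word_cat IHw eval_cons; congr (_ * _).
case: l => [b [[] t]]; last by rewrite /spell /= of_word_val.
rewrite /spell /is_xy /= of_word_cons of_word_nil mulg1.
by case: b.
Qed.

Lemma spell_avoids l : ~~ is_xy l -> all (fun k => k.2.1 != j) (spell l).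
Proof.
case: l => [b [[] t]] //= _; rewrite /spell /= /free_ext_letter /assign /=.
have inv g : avoids j g -> all (fun k => k.2.1 != j) (word_inv (val g)).
  move=> avg; apply/allP => k; rewrite mem_rev => /mapP[l lg ->] /=.
  exact: (allP avg).
by case: b; case: t => //; apply: inv.
Qed.

Lemma flatten_index (S : Type) (ss : seq (symbol * seq S)) s1 x s2 :
  flatten (unzip2 ss) = s1 ++ x :: s2 ->
  exists ss1 l t1 t2 ss2, [/\ ss = ss1 ++ (l, t1 ++ x :: t2) :: ss2,
    s1 = flatten (unzip2 ss1) ++ t1 & s2 = t2 ++ flatten (unzip2 ss2)].
Proof.
elim: ss s1 => [|[l s] ss IHs] s1 /=; first by case: s1.
move=> E; have [lt|le] := ltnP (size s1) (size s).
  have E1 := congr1 (take (size s1)) E.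
  rewrite (take_size_cat _ (erefl (size s1))) takel_cat ?(ltnW lt) // in E1.
  have E2 := congr1 (drop (size s1)) E.
  rewrite (drop_size_cat _ (erefl (size s1))) drop_cat lt in E2.
  case D: (drop (size s1) s) lt E2 => [|y t2] lt E2.
    by have := congr1 size D; rewrite size_drop /=; lia.
  case: E2 => yx E2; subst y.
  exists [::], l, s1, t2, ss; split=> //=.
  by rewrite -{1}E1 -D cat_take_drop.
have s1E : s1 = s ++ drop (size s) s1.
  have E1 := congr1 (take (size s)) E.
  by rewrite take_size_cat // takel_cat // in E1; rewrite {1}E1 cat_take_drop.
have [|ss1 [l' [t1 [t2 [ss2 [ssE s1E' s2E]]]]]] := IHs (drop (size s) s1).
  have := congr1 (drop (size s)) E.
  by rewrite drop_size_cat // {1}s1E -catA drop_size_cat.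
exists ((l, s) :: ss1), l', t1, t2, ss2; split=> //; first by rewrite ssE.
by rewrite s1E s1E' catA.
Qed.

Lemma flatten_subseq_size (ss : seq (symbol * spelling))
    (f : symbol -> spelling) :
  all (fun p => subseq p.2 (f p.1)) ss ->
  size (flatten (unzip2 ss)) <= size (flatten (map f (unzip1 ss))).
Proof.
elim: ss => //= p ss IHs /andP[/size_subseq sp /IHs].
by rewrite !size_cat; apply: leq_add.
Qed.

Lemma unzip1_cat (S R : Type) (s t : seq (S * R)) :
  unzip1 (s ++ t) = unzip1 s ++ unzip1 t.
Proof. exact: map_cat. Qed.

Lemma unzip2_cat (S R : Type) (s t : seq (S * R)) :
  unzip2 (s ++ t) = unzip2 s ++ unzip2 t.
Proof. exact: map_cat. Qed.

Lemma cat_split_left (S : Type) (s1 s2 t1 t2 : seq S) x (P : pred S) :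
  s1 ++ s2 = t1 ++ x :: t2 -> P x -> all (predC P) s2 ->
  exists t3, s1 = t1 ++ x :: t3 /\ t2 = t3 ++ s2.
Proof.
elim: s1 t1 => [|y s1 IHs] [|z t1] /=.
- by move=> -> Px /=; rewrite Px.
- by move=> -> Px; rewrite /= all_cat /= Px !andbF.
- by case=> -> <- _ _; exists s1.
by case=> -> E Px ns2; have [t3 [-> ->]] := IHs _ E Px ns2; exists t3.
Qed.

(** The first remaining letter of the level is either deleted or cancels with a
    later one.  The words enclosed by such a pair and outside of it are then
    trivialized independently.  A word without letters of the level
    is a region, whose norm is at most the number of letters deleted in it.
    Each pair in [z] records a symbol with what the deletion leaves of its
    spelling. *)
Lemma splits_of_deletion (z : seq (symbol * spelling)) m :
  all (fun p => subseq p.2 (spell p.1)) z ->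
  reduce (flatten (unzip2 z)) = [::] ->
  size (flatten (map spell (unzip1 z))) <= size (flatten (unzip2 z)) + m ->
  exists d rs, splits (unzip1 z) d rs /\
    d + \sum_(r <- rs) conj_norm (eval assign r) <= m.
Proof.
have [k] := ubnP (size z); elim: k z m => // k IHk z m ltk subz rz szz.
have catz1 (s t : seq (symbol * spelling)) p :
    size (flatten (map spell (unzip1 (s ++ p :: t)))) =
    (size (flatten (map spell (unzip1 s))) +
     (size (spell p.1) + size (flatten (map spell (unzip1 t)))))%N.
  by elim: s => [|q s IHs] /=; rewrite !size_cat /= ?IHs ?addnA // add0n.
have catz2 (s t : seq (symbol * spelling)) p :
    size (flatten (unzip2 (s ++ p :: t))) =
    (size (flatten (unzip2 s)) + (size p.2 + size (flatten (unzip2 t))))%N.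
  by elim: s => [|q s IHs] /=; rewrite !size_cat /= ?IHs ?addnA // add0n.
have [nogen|] := boolP (all (predC is_xy) (unzip1 z)).
  exists 0, [:: unzip1 z]; split; first exact: splits_region.
  rewrite big_seq1 add0n -of_word_spell.
  have := @conj_norm_subseq _ (flatten (unzip2 z)) (flatten (map spell (unzip1 z))).
  move/eqP: rz; rewrite -of_word_eq1 => /eqP->; rewrite invg1 mulg1.
  move=> le; apply: leq_trans (le _) _; last by rewrite leq_subLR.
  elim: z subz {ltk szz nogen le} => //= p z IHz /andP[sp sz].
  by rewrite cat_subseq // IHz.
rewrite -has_predC (eq_has (a2 := is_xy)); last by move=> l /=; rewrite negbK.
move=> hasg.
have [z0 [[a s] [z1 [zE ga nog0]]]] : exists z0 p z1,
  [/\ z = z0 ++ p :: z1, is_xy p.1 & all (predC (fun p => is_xy p.1)) z0].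
  elim: z hasg {ltk subz rz szz} => //= p z IHz.
  case gp: (is_xy p.1) => /=; first by exists [::], p, z.
  case/IHz=> z0 [q [z1 [-> gq g0]]].
  by exists (p :: z0), q, z1; rewrite /= gp g0.
rewrite /= in ga.
have spell_a : spell a = [:: (a.1, (j, a.2.2))] by rewrite /spell ga.
subst z; move: subz rz szz ltk.
rewrite all_cat unzip1_cat unzip2_cat map_cat !flatten_cat /= spell_a.
case/and3P=> sub0 suba sub1 rz szz ltk {hasg}.
have sz0 := flatten_subseq_size sub0; have sz1 := flatten_subseq_size sub1.
rewrite !size_cat /= in szz ltk.
case: s suba rz szz => [|x [|y s]] /= suba rz szz; last first.
- by case: ifP suba.
- have {suba} xE : x = (a.1, (j, a.2.2)) by move: suba; case: (x =P _).
  move/eqP: rz; rewrite reduce_nil_rot cat_cons => /eqP/reduce_partner.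
  case=> t1 [t2 [uE rt1 rt2]].
  have [|ss1 [l [p1 [p2 [ss2 [zE t1E t2E]]]]]] :=
      @flatten_index _ (z1 ++ z0) t1 (letter_inv x) t2.
    by rewrite unzip2_cat flatten_cat.
  have sub_l : subseq (p1 ++ letter_inv x :: p2) (spell l).
    have : all (fun p => subseq p.2 (spell p.1)) (z1 ++ z0) by rewrite all_cat sub1.
    by rewrite zE all_cat /= => /and3P[].
  have gl : is_xy l.
    apply: contraT => /spell_avoids/allP/(_ (letter_inv x)).
    rewrite (mem_subseq sub_l) ?mem_cat ?inE ?eqxx ?orbT // => /(_ isT).
    by rewrite xE /= eqxx.
  have [ss3 [z1E ss2E]] := @cat_split_left _ z1 z0 ss1 ss2 _ 
    (fun p => is_xy p.1) zE gl nog0.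
  have [p10 p20 lE] : [/\ p1 = [::], p2 = [::] & l = letter_inv a].
    have szl := size_subseq sub_l; move: szl sub_l.
    rewrite /spell gl size_cat /=.
    case: p1 {t1E zE z1E} => [|? ?] /=; last by rewrite addnS.
    case: p2 {t2E} => [|? ?] //= _; case: (letter_inv x =P _) => // xl _; split=> //.
    move: xl ga gl; rewrite xE /letter_inv /is_xy.
    by case: l => [? [? ?]]; case: a {spell_a xE} => [? [? ?]] /= [-> ->] -> ->.
  subst p1 p2 l ss2 z1; rewrite cats0 /= in t1E t2E.
  move: sub1; rewrite all_cat /= => /and3P[subs1 _ subs3].
  have szs1 := flatten_subseq_size subs1; have szs3 := flatten_subseq_size subs3.
  move: szz; rewrite catz1 catz2 /spell gl -/spell => szz.
  rewrite size_cat /= in ltk.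
  have [||||d [rs [Srs le1]]] := 
    IHk ss1 (size (flatten (map spell (unzip1 ss1))) -
             size (flatten (unzip2 ss1))).
  + by move: ltk; clear; lia.
  + by [].
  + by rewrite -t1E.
  + by rewrite subnKC.
  have [||||e [ss [Sss le2]]] := 
    IHk (z0 ++ ss3) (m - (size (flatten (map spell (unzip1 ss1))) -
                          size (flatten (unzip2 ss1)))).
  + by rewrite size_cat; move: ltk; clear; lia.
  + by rewrite all_cat sub0.
  + apply/eqP; rewrite unzip2_cat flatten_cat reduce_nil_rot.
    by rewrite -flatten_cat -unzip2_cat -t2E rt2.
  + rewrite unzip1_cat unzip2_cat map_cat !flatten_cat !size_cat.
    by move: szz szs1 szs3 sz0; clear => /=; lia.
  exists (d + e), (rs ++ ss); split.
    rewrite unzip1_cat; apply: splits_match => //; by move: Sss; rewrite unzip1_cat.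
  move: le1 le2 szz szs1 szs3 sz0; rewrite big_cat /=; clear; lia.
- have [||||d [rs [Srs le]]] := IHk (z0 ++ z1) m.-1.
  + by rewrite size_cat; move: ltk; clear; lia.
  + by rewrite all_cat sub0.
  + by rewrite unzip2_cat flatten_cat.
  + rewrite unzip1_cat unzip2_cat map_cat !flatten_cat !size_cat.
    by move: szz sz0 sz1; clear; lia.
  exists d.+1, rs; split.
    by apply: splits_delete => //; move: Srs; rewrite unzip1_cat.
  by move: le szz sz0 sz1; clear; lia.
Qed.

Lemma subseq_flatten (S : eqType) (u : seq S) (f : symbol -> seq S) w :
  subseq u (flatten (map f w)) ->
  exists z, [/\ unzip1 z = w, flatten (unzip2 z) = u
              & all (fun p => subseq p.2 (f p.1)) z].
Proof.
elim: w u => [|l w IHw] u /=.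
  by move=> /eqP->; exists [::].
case/subseq_cat_split=> u1 [u2 [-> s1 /IHw[z [zw zu sz]]]].
by exists ((l, u1) :: z); rewrite /= zw zu s1.
Qed.

(** What the norm of a word over [x], [y], [V] and [c] pays for: the deleted
    letters of the level, and the regions one by one. *)
Lemma splits_of_norm w : exists d rs, splits w d rs /\
  d + \sum_(r <- rs) conj_norm (eval assign r) <= conj_norm (eval assign w).
Proof.
rewrite -(of_word_spell w).
have [u [sub ru szu]] := conj_norm_deletion (flatten (map spell w)).
have [z [zw zu sz]] := subseq_flatten sub; subst w u.
exact: splits_of_deletion sz ru szu.
Qed.

End Regions.

(** * Invariants of a splitting *)

Section Weights.
Import GRing.Theory.
Local Open Scope ring_scope.

Definition weight (E : bool * bool -> int) (w : seq symbol) : int :=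
  \sum_(l <- w) (if l.1 then - E l.2 else E l.2).

Lemma weight_cat E u v : weight E (u ++ v) = weight E u + weight E v.
Proof. exact: big_cat. Qed.

Lemma weight_cons E l v :
  weight E (l :: v) = (if l.1 then - E l.2 else E l.2) + weight E v.
Proof. exact: big_cons. Qed.

Lemma weight_nil E : weight E [::] = 0.
Proof. exact: big_nil. Qed.

Lemma weight_inv E w : weight E (word_inv w) = - weight E w.
Proof.
elim: w => [|l w IHw]; first by rewrite weight_nil oppr0.
rewrite /word_inv /= rev_cons -cats1 weight_cat -/(word_inv w) IHw.
by rewrite !weight_cons weight_nil; case: l => [[] t] /=; ring.
Qed.

Lemma weight_pow E w n : weight E (flatten (nseq n w)) = n%:Z * weight E w.
Proof.
elim: n => [|n IHn] /=; first by rewrite weight_nil mul0r.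
by rewrite weight_cat IHn intS; ring.
Qed.

(** Additive invariants that ignore [x] and [y] pass to the regions: a matched
    pair contributes opposite weights and a deleted letter weight 0. *)
Lemma splits_weight E w d rs : (forall t, E (true, t) = 0) ->
  splits w d rs -> weight E w = \sum_(r <- rs) weight E r.
Proof.
move=> E0; elim=> [u _|a w1 w2 d' ss ga _ IH|a w1 w2 w3 d' e ss ts ga _ IH1 _ IH2].
- by rewrite big_seq1.
- rewrite -IH !weight_cat weight_cons.
  by case: a ga => [b [[] t]] //= _; rewrite E0; case: b; ring.
- rewrite big_cat /= -IH1 -IH2 !weight_cat !weight_cons weight_cat weight_cons.
  by case: a ga => [b [[] t]] //= _; rewrite E0; case: b; ring.
Qed.

End Weights.

Lemma splits_regions w d rs : splits w d rs -> all (all (predC is_xy)) rs.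
Proof.
elim=> [u nou|//|a w1 w2 w3 d' e ss ts _ _ n1 _ n2]; first by rewrite /= nou.
by rewrite all_cat n1.
Qed.

(** The surviving letters come in pairs. *)
Lemma splits_parity w d rs : splits w d rs -> odd (count is_xy w) = odd d.
Proof.
elim=> [u nou|a w1 w2 d' ss ga _ IH|a w1 w2 w3 d' e ss ts ga _ IH1 _ IH2].
- by move: nou; rewrite all_predC has_count -leqNgt leqn0 => /eqP->.
- by rewrite /= -IH !count_cat /= ga !oddD /=; case: odd => //=; case: odd.
- rewrite oddD -IH1 -IH2 !count_cat /= count_cat /= ga.
  have -> : is_xy (letter_inv a) by [].
  by rewrite !oddD /=; case: (odd _) => //=; case: (odd _) => //=; case: (odd _).
Qed.

Section Substitution.
Variable theta : bool * bool -> seq symbol.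

Definition subst_letter (l : symbol) : seq symbol :=
  if l.1 then word_inv (theta l.2) else theta l.2.

Definition subst (w : seq symbol) : seq symbol := flatten (map subst_letter w).

Lemma eval_subst (G : groupType) (f : bool * bool -> G) w :
  eval f (subst w) = eval (fun t => eval f (theta t)) w.
Proof.
elim: w => [|l w IHw]; first by rewrite !eval_nil.
rewrite /subst /= eval_cat -/(subst w) IHw eval_cons; congr (_ * _).
by case: l => [[] t]; rewrite /subst_letter /free_ext_letter /= ?eval_inv.
Qed.

Lemma weight_subst E w : weight E (subst w) = weight (fun t => weight E (theta t)) w.
Proof.
elim: w => [|l w IHw]; first by rewrite !weight_nil.
rewrite /subst /= weight_cat -/(subst w) IHw weight_cons; congr (_ + _)%R.
by case: l => [[] t]; rewrite /subst_letter /= ?weight_inv.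
Qed.

Lemma count_xy_inv w : count is_xy (word_inv w) = count is_xy w.
Proof. by rewrite /word_inv count_rev count_map; apply: eq_count => l. Qed.

Lemma count_xy_subst w :
  (forall t, ~~ t.1 -> ~~ odd (count is_xy (theta t))) ->
  all (predC is_xy) w -> ~~ odd (count is_xy (subst w)).
Proof.
move=> ev; elim: w => //= l w IHw /andP[nl /IHw{}IHw]; rewrite /subst /= count_cat oddD.
rewrite -/(subst w) (negbTE IHw) addbF /subst_letter.
by case: l.1; rewrite ?count_xy_inv; apply: ev.
Qed.

End Substitution.

Section Actions.
Import GRing.Theory Num.Theory.
Local Open Scope ring_scope.
Variable act : symbol -> int -> int.
Hypothesis actK : forall l z, act l (act (letter_inv l) z) = z.

Definition run (w : seq symbol) (z : int) : int := foldr act z w.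

Lemma run_cat u v z : run (u ++ v) z = run u (run v z).
Proof. exact: foldr_cat. Qed.

Lemma run_cons l w z : run (l :: w) z = act l (run w z).
Proof. by []. Qed.

Lemma run_inv w z : run (word_inv w) (run w z) = z.
Proof.
elim: w z => //= l w IHw z; rewrite /word_inv /= rev_cons -cats1 run_cat /=.
by rewrite -{2}(letter_invK l) actK IHw.
Qed.

Lemma run_inv_shift w t :
  (forall z, run w z = z + t) -> forall z, run (word_inv w) z = z - t.
Proof. by move=> wt z; rewrite -{1}(subrK t z) -wt run_inv. Qed.

Lemma run_pow w n t :
  (forall z, run w z = z + t) -> forall z, run (flatten (nseq n w)) z = z + n%:Z * t.
Proof.
move=> wt z; elim: n => [|n IHn] /=; first by rewrite mul0r addr0.
by rewrite run_cat IHn wt intS; ring.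
Qed.

Lemma run_subst_shift theta E w :
  (forall t, ~~ t.1 -> forall z, run (theta t) z = z + E t) ->
  all (predC is_xy) w -> forall z, run (subst theta w) z = z + weight E w.
Proof.
move=> thE; elim: w => [|l w IHw] /=; first by move=> _ z; rewrite weight_nil addr0.
case/andP=> nl /IHw{}IHw z; rewrite run_cat IHw weight_cons.
case: l nl => [[] t] /= nt; rewrite /subst_letter /=.
  by rewrite (run_inv_shift (thE _ nt)); ring.
by rewrite thE //; ring.
Qed.

(** If the regions act trivially and nothing is deleted, then all matched pairs
    collapse one after the other. *)
Lemma run_splits_id w d rs : splits w d rs -> d = 0 ->
  (forall r, r \in rs -> run r =1 id) -> run w =1 id.
Proof.
elim=> [u _|//|a w1 w2 w3 d' e ss ts ga _ IH1 _ IH2].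
  by move=> _; apply; rewrite inE.
move=> de0 rid z; rewrite !run_cat /= run_cat /= IH1 ?actK -?run_cat.
- by apply: IH2 => [|r rts]; [lia | apply: rid; rewrite mem_cat rts orbT].
- by lia.
- by move=> r rss; apply: rid; rewrite mem_cat rss.
Qed.

Hypothesis act_isometry : forall l y z, `|act l y - act l z| = `|y - z|.

Lemma run_isometry w y z : `|run w y - run w z| = `|y - z|.
Proof. by elim: w => //= l w IHw; rewrite act_isometry. Qed.

Hypothesis act_xy : forall a z, is_xy a -> `|act a z - z| <= 1.

(** When the regions act trivially, only the deleted letters can move a point, by
    at most one each, and isometries carry these displacements along. *)
Lemma run_splits_le w d rs : splits w d rs ->
  (forall r, r \in rs -> run r =1 id) -> forall z, `|run w z - z| <= d%:Z.
Proof.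
elim=> [u _|a w1 w2 d' ss ga _ IH|a w1 w2 w3 d' e ss ts ga _ IH1 _ IH2] rid z.
- by rewrite rid ?inE // subrr.
- rewrite run_cat /=; have := IH rid z; rewrite run_cat.
  have := run_isometry w1 (act a (run w2 z)) (run w2 z).
  by have := act_xy (run w2 z) ga; lia.
- rewrite run_cat /= run_cat /=.
  set y := act (letter_inv a) (run w3 z).
  have id1 r : r \in ss -> run r =1 id by move=> rss; apply: rid; rewrite mem_cat rss.
  have id2 r : r \in ts -> run r =1 id.
    by move=> rts; apply: rid; rewrite mem_cat rts orbT.
  have := IH2 id2 z; rewrite run_cat -{1}(actK a (run w3 z)) -/y.
  have := IH1 id1 y; rewrite -(act_isometry a) -(run_isometry w1).
  lia.
Qed.

End Actions.
Arguments run act w z : simpl never.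

(** * The substitution made at one level *)

Definition twist (G : groupType) (n : nat) (p q : G) : G :=
  (p * q) ^+ n * (p^-1 * q^-1) ^+ n.

Definition sym_x : symbol := (false, (true, false)).
Definition sym_y : symbol := (false, (true, true)).
Definition sym (b : bool) : symbol := (false, (false, b)).

Definition twist_word (n : nat) (b : bool) : seq symbol :=
  let p := [:: sym_x; sym b] in let q := [:: sym_y; sym b] in
  flatten (nseq n (p ++ q)) ++ flatten (nseq n (word_inv p ++ word_inv q)).

Lemma eval_twist_word (G : groupType) (f : bool * bool -> G) n b :
  eval f (twist_word n b) =
  twist n (f (true, false) * f (false, b)) (f (true, true) * f (false, b)).
Proof.
rewrite /twist_word eval_cat !eval_pow !eval_cat !eval_inv.
by rewrite !eval_cons !eval_nil !mulg1.
Qed.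

Lemma count_xy_twist n b : ~~ odd (count is_xy (twist_word n b)).
Proof.
rewrite /twist_word count_cat !count_flatten !map_nseq !sumn_nseq /=.
by rewrite oddD !oddM.
Qed.

(** What [V] and [c] become when a level is added; [o] tells whether its index is
    odd. *)
Definition step (n : nat) (o : bool) (t : bool * bool) : seq symbol :=
  if o then
    if t.2 then word_inv (twist_word n true) ++ [:: (false, t)]
    else (false, t) :: twist_word n true
  else (false, t) :: twist_word n false.

Section Exponents.
Import GRing.Theory Num.Theory.
Local Open Scope ring_scope.

Definition expo (b : bool) (w : seq symbol) : int :=
  weight (fun t => (t == (false, b))%:Z) w.

Lemma weight_twist E n b : weight E (twist_word n b) = 0.
Proof.
rewrite /twist_word weight_cat !weight_pow !weight_cat !weight_inv -mulrDr.
by rewrite (_ : _ + _ = 0) ?mulr0 //; ring.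
Qed.

Lemma weight_ext E E' w : all (predC is_xy) w ->
  (forall t, ~~ t.1 -> E t = E' t) -> weight E w = weight E' w.
Proof.
move=> nw EE'; rewrite /weight big_seq [RHS]big_seq.
apply: eq_bigr => l lw; have nl := allP nw l lw.
by rewrite (EE' l.2 nl).
Qed.

Lemma weight_step E n o w : all (predC is_xy) w ->
  weight E (subst (step n o) w) = weight E w.
Proof.
move=> nw; rewrite weight_subst; apply: weight_ext => // t _.
case: t => a b; rewrite /step; case: o; case: b => /=;
by rewrite ?weight_cat ?weight_inv !weight_cons ?weight_nil weight_twist /=; ring.
Qed.

Lemma splits_expo b n o w d rs : all (predC is_xy) w ->
  splits (subst (step n o) w) d rs -> \sum_(r <- rs) expo b r = expo b w.
Proof.
move=> nw sw; rewrite -[RHS](weight_step _ n o nw).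
by rewrite /expo (splits_weight (E := fun t => (t == (false, b))%:Z) _ sw).
Qed.

Lemma splits_even n o w d rs : all (predC is_xy) w ->
  splits (subst (step n o) w) d rs -> ~~ odd d.
Proof.
move=> nw /splits_parity <-.
apply: count_xy_subst nw => -[[] b] //= _.
have c := count_xy_twist n; rewrite /step.
case: o; last exact: c.
case: b; last exact: c.
by rewrite (count_cat _ (word_inv _)) count_xy_inv oddD addbF.
Qed.

Definition reflect_xy (l : symbol) (z : int) : int :=
  if l.2.1 then (if l.2.2 then - z else 1 - z) else z.

Lemma reflect_xyK l z : reflect_xy l (reflect_xy (letter_inv l) z) = z.
Proof. by case: l => [b [[] []]]; rewrite /reflect_xy /=; ring. Qed.

Lemma run_reflect_twist n b z :
  run reflect_xy (twist_word n b) z = z + (2 * n)%N%:Z.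
Proof.
rewrite /twist_word run_cat !(@run_pow _ _ _ 1); first by lia.
  by move=> y; rewrite /run /= /reflect_xy /=; ring.
by move=> y; rewrite /run /= /reflect_xy /=; ring.
Qed.

(** Let [x] and [y] act as two reflections generating the infinite dihedral group
    and [V], [c] trivially.  The twist is then a translation by [2n], so
    a word whose total exponent of twists is nonzero acts nontrivially and some
    letter is deleted; by parity, at least two are. *)
Lemma splits_ge2 n o w d rs : (0 < n)%N -> all (predC is_xy) w ->
  splits (subst (step n o) w) d rs ->
  (if o then expo false w != expo true w else expo false w + expo true w != 0) ->
  (2 <= d)%N.
Proof.
move=> n0 nw sw ne; have ed := splits_even nw sw.
case: d sw ed => [|[|d]] // sw _; exfalso.
have rid r : r \in rs -> run reflect_xy r =1 id.
  move=> rrs; have := allP (splits_regions sw) r rrs.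
  elim: r {rrs} => // l r IHr /andP[nl /IHr{}IHr] z.
  by rewrite run_cons IHr /reflect_xy; move: nl; rewrite /is_xy => /negbTE->.
have := run_splits_id reflect_xyK sw erefl rid 0.
pose E (t : bool * bool) : int := if o && t.2 then - (2 * n)%N%:Z else (2 * n)%N%:Z.
rewrite (@run_subst_shift _ reflect_xyK _ E) //; last first.
  have inv := run_inv_shift reflect_xyK (run_reflect_twist n true).
  move=> [a b] /= /negbTE-> z; rewrite /E /step {E ne sw}.
  case: o => /=; last by rewrite run_cons run_reflect_twist /reflect_xy.
  case: b => /=; last by rewrite run_cons run_reflect_twist /reflect_xy.
  by rewrite run_cat run_cons inv /reflect_xy.
rewrite add0r.
have -> : weight E w = (2 * n)%N%:Z * 
    (if o then expo false w - expo true w else expo false w + expo true w).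
  elim: w nw {ne sw} => [_|l w IHw /= /andP[nl /IHw{}IHw]].
    by rewrite /expo !weight_nil; case: (o); ring.
  rewrite /expo !weight_cons -!/(expo _ _) IHw.
  by case: l nl => [a [[] b]] //= _; rewrite /E; case: a; case: (o); case: b => /=; ring.
by move: ne; case: (o) => ne; nia.
Qed.

(** [x] translates by 1, [y] by -1, and the letter [s] is the reflection at 0. *)
Definition reflect_letter (s : bool) (l : symbol) (z : int) : int :=
  if l.2.1 then (if l.1 (+) l.2.2 then z - 1 else z + 1)
  else if l.2.2 == s then - z else z.

Lemma reflect_letterK s l z :
  reflect_letter s l (reflect_letter s (letter_inv l) z) = z.
Proof.
rewrite /reflect_letter; case: l => [a [[] b]] /=;
  first by case: a; case: b => /=; ring.
by case: eqP => _ //; ring.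
Qed.

Lemma run_reflect_letter_twist n s z :
  run (reflect_letter s) (twist_word n s) z = z + (4 * n)%N%:Z.
Proof.
rewrite /twist_word run_cat !(@run_pow _ _ _ 2); first by lia.
  by move=> y; rewrite /run /= /reflect_letter /= eqxx; ring.
by move=> y; rewrite /run /= /reflect_letter /= eqxx; ring.
Qed.

Lemma run_reflect_letter_even s r : all (predC is_xy) r ->
  ~~ odd `|expo s r|%N -> run (reflect_letter s) r =1 id.
Proof.
move=> nr er z.
suff -> : run (reflect_letter s) r z = if odd `|expo s r|%N then - z else z.
  by rewrite (negbTE er).
elim: r nr {er} => [_|l r IHr /andP[nl /IHr{}IHr]].
  by rewrite /expo weight_nil.
rewrite run_cons IHr /expo weight_cons -/(expo s r); case: l nl => [a [[] b]] //= _.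
rewrite /reflect_letter /= xpair_eqE /=.
case: eqP => _ /=; last by case: a; rewrite ?oppr0 add0r.
by case: a => /=; case: ifP => o1; case: ifP => o2; lia.
Qed.

(** Equivalently, both twist exponents [expo false w + expo true w] and
    [expo false w - expo true w], at even and at odd levels, are odd. *)
Definition good (w : seq symbol) : bool := odd `|(expo false w + expo true w)%R|%N.

(** Here [s] is the letter attached to [x] and [y] in the twist, and it acts as a
    reflection, which turns the twist into a translation by [4n].  Words in
    which [s] has even exponent act trivially, so the regions do, while the
    word moves 0 by an odd multiple of [4n]. *)
Lemma splits_ge4n n s w d rs : all (predC is_xy) w -> good w ->
  splits (subst (step n s) w) d rs ->
  (forall r, r \in rs -> ~~ odd `|expo s r|%N) -> (4 * n <= d)%N.
Proof.
move=> nw gw sw ev.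
have isom l y z : `|reflect_letter s l y - reflect_letter s l z| = `|y - z|.
  by rewrite /reflect_letter; case: l => [a [[] b]] /=; [case: ifP | case: ifP]; lia.
have gen1 a z : is_xy a -> `|reflect_letter s a z - z| <= 1.
  by case: a => [a [[] b]] //= _; rewrite /reflect_letter /=; case: ifP; lia.
have := run_splits_le (@reflect_letterK s) isom gen1 sw.
move=> /(_ _ 0); rewrite subr0 => le.
have {le} : `|run (reflect_letter s) (subst (step n s) w) 0| <= d%:Z.
  apply: le => r rrs; apply: run_reflect_letter_even (ev r rrs).
  exact: (allP (splits_regions sw) r rrs).
suff [q [-> oq]] : exists q : int,
    run (reflect_letter s) (subst (step n s) w) 0 = (4 * n)%N%:Z * q /\ odd `|q|%N.
  have q1 : 1 <= `|q| by lia.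
  rewrite normrM => le; have := ler_wpM2l (normr_ge0 (4 * n)%N%:Z) q1.
  by lia.
suff [q [qE ow]] : exists q : int,
    run (reflect_letter s) (subst (step n s) w) 0 = (4 * n)%N%:Z * q /\
    odd `|q|%N = good w.
  by exists q; rewrite ow.
(* each step is a translation by 4n, up to sign and composed with the
   reflection when its letter is s, so it flips the parity of q *)
have inv := run_inv_shift (@reflect_letterK s) (@run_reflect_letter_twist n s).
have stepE b z : run (reflect_letter s) (step n s (false, b)) z =
    if b == s then - (z + (4 * n)%N%:Z) else z + (4 * n)%N%:Z.
  have fwd := run_reflect_letter_twist n s.
  rewrite /step; move: fwd inv; case: (s) => fwd inv.
    case: b => /=; last by rewrite run_cons fwd.
    by rewrite run_cat inv run_cons /= /reflect_letter /=; ring.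
  by case: b; rewrite /= run_cons fwd.
have stepVE b z : run (reflect_letter s) (word_inv (step n s (false, b))) z =
    if b == s then - z - (4 * n)%N%:Z else z - (4 * n)%N%:Z.
  have := run_inv (@reflect_letterK s) (step n s (false, b))
    (if b == s then - z - (4 * n)%N%:Z else z - (4 * n)%N%:Z).
  rewrite stepE; case: (b == s) => H; rewrite -[RHS]H; congr (run _ _ _); ring.
elim: w nw {gw sw} => [_|l w IHw /andP[nl /IHw[q [IHq oq]]]].
  by exists 0; rewrite mulr0 /good /expo !weight_nil.
pose e : int := if l.1 then -1 else 1.
exists (if l.2.2 == s then - (q + 1) else q + e).
rewrite /subst /= run_cat IHq; split.
  case: l nl @e => [[] [[] b]] //= _; rewrite /subst_letter /= ?stepVE ?stepE.
    by case: eqP => _; ring.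
  by case: eqP => _; ring.
rewrite /good /expo !weight_cons -!/(expo _ w) /e.
case: l nl {e} => [a [[] b]] //= _; rewrite /= !xpair_eqE /=.
move: oq; rewrite /good; case: a; case: b; case: (s) => /=; lia.
Qed.

End Exponents.

(** * The factors accumulated by the homomorphisms *)

(** The composite of the homomorphisms of the top levels maps [s_i] to
    [s_i tV] for even [i] and to [tO^-1 s_i tE] for odd [i]; thus [tE] and [tO]
    collect the twists of even and odd level, and [tV] all of them. *)
Record factors := Factors { tV : F_infty; tE : F_infty; tO : F_infty }.

Definition tC (t : factors) : F_infty := (tO t)^-1 * tE t.

Definition level_twist (n j : nat) (t : factors) : F_infty :=
  if odd j then twist n ((tO t)^-1 * x_ j * tE t) ((tO t)^-1 * y_ j * tE t)
  else twist n (x_ j * tV t) (y_ j * tV t).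

(** The [m] top levels are [2n], [2n-1], ..., [2n-m+1]; the next one has index
    [2n-m], of the same parity as [m]. *)
Fixpoint tower (n m : nat) : factors :=
  if m is m'.+1 then
    let t := tower n m' in let tau := level_twist n (2 * n - m') t in
    if odd m' then Factors (tV t * tau) (tE t) (tO t * tau)
    else Factors (tV t * tau) (tE t * tau) (tO t)
  else Factors 1 1 1.

Section Recursion.
Variable n : nat.

Definition psi (ks : seq nat) (g : F_infty) : F_infty :=
  foldl (fun g k => phi n k g) g ks.

Lemma psiM ks : {morph psi ks : g h / g * h}.
Proof.
elim: ks => // k ks IH g h.
change (psi ks (phi n k (g * h)) = psi ks (phi n k g) * psi ks (phi n k h)).
rewrite -IH; congr (psi ks _); exact: (free_extM (phi_gen n k) g h).
Qed.

Lemma psi1 ks : psi ks 1 = 1.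
Proof. by apply: (mulgI (psi ks 1)); rewrite -psiM !mulg1. Qed.

Lemma psiV ks : {morph psi ks : g / g^-1}.
Proof. by move=> g; apply: (mulgI (psi ks g)); rewrite -psiM !mulgV psi1. Qed.

Lemma psiX ks i : {morph psi ks : g / g ^+ i}.
Proof. by move=> g; elim: i => [|i IH]; rewrite ?expg0 ?psi1 // !expgS psiM IH. Qed.

Lemma odd_level m : m <= 2 * n -> odd (2 * n - m) = odd m.
Proof. by move=> le; rewrite oddB // oddM. Qed.

(** The homomorphism of the new level is applied first, so the higher levels turn
    its [T_k] into the twist of the images of [x_k] and [y_k]. *)
Lemma psi_gen m s : m <= 2 * n ->
  psi (iota (2 * n - m).+1 m) (free_gen s) =
  if odd s.1 then (tO (tower n m))^-1 * free_gen s * tE (tower n m)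
  else free_gen s * tV (tower n m).
Proof.
elim: m s => [|m IHm] s le; first by rewrite /= invg1 mul1g mulg1; case: odd.
have jE : (2 * n - m.+1).+1 = (2 * n - m)%N by lia.
have psi_tau : psi (iota (2 * n - m).+1 m) (T_ n (2 * n - m)) =
    level_twist n (2 * n - m) (tower n m).
  rewrite /T_ psiM !psiX !psiM !psiV /x_ /y_ !IHm ?(ltnW le) //=.
  by rewrite /level_twist; case: ifP.
rewrite jE /= /phi -/(psi _ _) free_ext_gen /phi_gen odd_level ?(ltnW le) //.
case os: (odd s.1); case om: (odd m) => /=;
  rewrite psiM ?psiV psi_tau IHm ?(ltnW le) // os ?invgM ?mulgA //.
Qed.

Lemma g_tower : 1 < n -> g_ n = x_ 0 * tV (tower n (2 * n - 2)).
Proof.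
move=> n1; rewrite /g_ /index_iota -/(psi _ _).
have <- : ((2 * n - (2 * n - 2)).+1 = 3)%N by lia.
have <- : ((2 * n - 2) = (2 * n).+1 - (2 * n - (2 * n - 2)).+1)%N by lia.
by rewrite /x_ psi_gen //; lia.
Qed.

End Recursion.

Section Subgroup.
Variables (n : nat) (H : {pred F_infty}).
Hypotheses (cH : group_closed H) (sH : {subset mem (gens_upto (2 * n)) <= H}).

Let HM g h : g \in H -> h \in H -> g * h \in H.
Proof. exact: (group_closedM cH). Qed.
Let HV g : g \in H -> g^-1 \in H.
Proof. exact: (group_closedV cH). Qed.
Let H1 : 1 \in H. Proof. by case: cH. Qed.
Let HX g i : g \in H -> g ^+ i \in H.
Proof. by move=> gH; elim: i => [|i IH]; rewrite ?expg0 ?H1 // expgS HM. Qed.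

Lemma x_in_subgroup j : j <= 2 * n -> x_ j \in H.
Proof.
move=> le; apply: sH; rewrite [_ \in _]mem_cat; apply/orP; left.
by apply/mapP; exists j; rewrite // mem_iota.
Qed.

Lemma y_in_subgroup j : j <= 2 * n -> y_ j \in H.
Proof.
move=> le; apply: sH; rewrite [_ \in _]mem_cat; apply/orP; right.
by apply/mapP; exists j; rewrite // mem_iota.
Qed.

Lemma tower_in_subgroup m :
  [/\ tV (tower n m) \in H, tE (tower n m) \in H & tO (tower n m) \in H].
Proof.
elim: m => [|m [VH EH OH]]; first by rewrite !H1.
have xH := @x_in_subgroup (2 * n - m) (leq_subr _ _).
have yH := @y_in_subgroup (2 * n - m) (leq_subr _ _).
have tauH : level_twist n (2 * n - m) (tower n m) \in H.
  by rewrite /level_twist; case: ifP => _; rewrite /twist;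
     do ![apply: HM | apply: HX | apply: HV].
by rewrite /=; case: ifP => _ /=; split=> //; apply: HM.
Qed.

End Subgroup.

Lemma g_generated n : 1 < n -> generated (mem (gens_upto (2 * n))) (g_ n).
Proof.
move=> n1 H cH sH; rewrite g_tower //.
have [VH _ _] := tower_in_subgroup cH sH (2 * n - 2).
by apply: (group_closedM cH) => //; apply: (x_in_subgroup sH).
Qed.

(** * Upper bounds *)

Section Distance.
Variable T : choiceType.
Implicit Types g h c p q : free_group T.

Definition dist g h := conj_norm (g * h^-1).

Lemma dist_refl g : dist g g = 0%N.
Proof. by rewrite /dist mulgV conj_norm1. Qed.

Lemma conj_norm_dist g h : conj_norm g <= dist g h + conj_norm h.
Proof. by rewrite /dist -{1}(mulgVK h g) conj_normM. Qed.

Lemma distM g g' h h' : dist (g * g') (h * h') <= dist g h + dist g' h'.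
Proof.
rewrite /dist invgM -[X in X <= _](conj_normJ _ g).
have -> : (g * g' * (h'^-1 * h^-1)) ^ g = (g' * h'^-1) * (h^-1 * g).
  by rewrite conjgE !mulgA mulVg mul1g.
by apply: leq_trans (conj_normM _ _) _; rewrite addnC leq_add // conj_normC.
Qed.

Lemma distV g h : dist g^-1 h^-1 = dist g h.
Proof. by rewrite /dist invgK conj_normC -conj_normV invgM invgK. Qed.

Lemma distM_le g g' h h' a b : dist g h <= a -> dist g' h' <= b ->
  dist (g * g') (h * h') <= a + b.
Proof. by move=> da db; apply: leq_trans (distM _ _ _ _) (leq_add da db). Qed.

Lemma distV_le g h a : dist g h <= a -> dist g^-1 h^-1 <= a.
Proof. by rewrite distV. Qed.

Lemma dist0_le g : dist g g <= 0.
Proof. by rewrite dist_refl. Qed.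

Lemma conj_norm_dist_le k g h : dist g h <= k -> conj_norm g <= k + conj_norm h.
Proof. by move=> gh; apply: leq_trans (conj_norm_dist g h) _; rewrite leq_add2r. Qed.

Lemma expg_shift p q i : (p * q) ^+ i * p = p * (q * p) ^+ i.
Proof.
by elim: i => [|i IH]; rewrite ?expg0 ?mul1g ?mulg1 // !expgS -!mulgA IH !mulgA.
Qed.

(** The two ways of writing a twist as a commutator: [p w p^-1 w^-1] and
    [v q v^-1 q^-1].  Both factorizations of each half are kept, because products
    of two twists mix them. *)
Lemma twist_factors n p q : 0 < n -> exists w v,
  [/\ (p * q) ^+ n = p * w, (p^-1 * q^-1) ^+ n = p^-1 * w^-1,
      (p * q) ^+ n = v * q & (p^-1 * q^-1) ^+ n = v^-1 * q^-1].
Proof.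
case: n => // n _; exists (q * (p * q) ^+ n), ((p * q) ^+ n * p).
split.
- by rewrite expgS mulgA.
- by rewrite expgS invgM -expVgn invgM -mulgA -expg_shift.
- by rewrite expgSr mulgA.
- by rewrite expgSr invgM -expVgn invgM -expg_shift mulgA.
Qed.

Section Deletion.
Variables (n : nat) (x y c : free_group T).
Hypotheses (n0 : 0 < n) (x1 : conj_norm x <= 1) (y1 : conj_norm y <= 1).
Let tau := twist n (x * c) (y * c).

Let xc : dist (x * c) c <= 1. Proof. by rewrite /dist mulgK. Qed.
Let yc : dist (y * c) c <= 1. Proof. by rewrite /dist mulgK. Qed.

Lemma twist_dist_left : exists w, dist tau (c * w * (c^-1 * w^-1)) <= 2.
Proof.
have [w [v [E1 E2 _ _]]] := twist_factors (x * c) (y * c) n0.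
exists w; rewrite /tau /twist E1 E2.
exact: distM_le (distM_le xc (dist0_le w)) (distM_le (distV_le xc) (dist0_le w^-1)).
Qed.

Lemma twist_dist_right : exists w, dist tau (w * c * (w^-1 * c^-1)) <= 2.
Proof.
have [w [v [_ _ E1 E2]]] := twist_factors (x * c) (y * c) n0.
exists v; rewrite /tau /twist E1 E2.
exact: distM_le (distM_le (dist0_le v) yc) (distM_le (dist0_le v^-1) (distV_le yc)).
Qed.

(** In [tau g tau h] delete an [x] in the second half of the first twist and in the
    first half of the second one, and a [y] in the two outer halves.  The
    remaining outer and inner factors [v] and [w] then conjugate [g c]. *)
Lemma twist_pair_left g h :
  conj_norm (tau * g * (tau * h)) <= 4 + (conj_norm (g * c) + conj_norm (c^-1 * h)).
Proof.
have [w [v [E1 E2 E3 E4]]] := twist_factors (x * c) (y * c) n0.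
have -> : tau * g * (tau * h) = (v * (y * c)) * ((x * c)^-1 * w^-1) * g *
    ((x * c) * w * (v^-1 * (y * c)^-1) * h).
  by rewrite -E1 -E2 -E3 -E4.
have := conj_norm_dist_le (distM_le (distM_le (distM_le
  (distM_le (dist0_le v) yc) (distM_le (distV_le xc) (dist0_le w^-1))) (dist0_le g))
  (distM_le (distM_le (distM_le xc (dist0_le w))
    (distM_le (dist0_le v^-1) (distV_le yc)))
  (dist0_le h))).
move=> le; apply: leq_trans le _; rewrite leq_add2l.
have -> : v * c * (c^-1 * w^-1) * g * (c * w * (v^-1 * c^-1) * h) =
    (g * c) ^ (w * v^-1) * (c^-1 * h).
  by rewrite conjgE invgM invgK !mulgA mulgK.
by apply: leq_trans (conj_normM _ _) _; rewrite conj_normJ.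
Qed.

(** The same with the roles of [x] and [y] exchanged, which moves the factor [c]
    to the other side. *)
Lemma twist_pair_right g h :
  conj_norm (tau * g * (tau * h)) <= 4 + (conj_norm (c^-1 * g) + conj_norm (h * c)).
Proof.
have [w [v [E1 E2 E3 E4]]] := twist_factors (x * c) (y * c) n0.
have -> : tau * g * (tau * h) = ((x * c) * w) * (v^-1 * (y * c)^-1) * g *
    (v * (y * c) * ((x * c)^-1 * w^-1) * h).
  by rewrite -E3 -E4 -E1 -E2.
have := conj_norm_dist_le (distM_le (distM_le (distM_le
  (distM_le xc (dist0_le w)) (distM_le (dist0_le v^-1) (distV_le yc))) (dist0_le g))
  (distM_le (distM_le (distM_le (dist0_le v) yc)
    (distM_le (distV_le xc) (dist0_le w^-1)))
  (dist0_le h))).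
move=> le; apply: leq_trans le _; rewrite leq_add2l.
have -> : c * w * (v^-1 * c^-1) * g * (v * c * (c^-1 * w^-1) * h) =
    c * ((c^-1 * g) ^ (v * w^-1) * h).
  by rewrite conjgE invgM invgK !mulgA mulgK.
rewrite conj_normC -mulgA.
by apply: leq_trans (conj_normM _ _) _; rewrite conj_normJ.
Qed.

Lemma twist_mul_left g :
  conj_norm (g * tau) <= 2 + (conj_norm (g * c) + conj_norm c).
Proof.
have [w dw] := twist_dist_left.
apply: leq_trans (conj_norm_dist_le (distM_le (dist0_le g) dw)) _.
rewrite leq_add2l; have -> : g * (c * w * (c^-1 * w^-1)) = (g * c) * c^-1 ^ w^-1.
  by rewrite conjgE invgK !mulgA.
by apply: leq_trans (conj_normM _ _) _; rewrite conj_normJ conj_normV.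
Qed.

Lemma twist_mul_right g :
  conj_norm (g * tau) <= 2 + (conj_norm (g * c^-1) + conj_norm c).
Proof.
have [w dw] := twist_dist_right.
apply: leq_trans (conj_norm_dist_le (distM_le (dist0_le g) dw)) _.
rewrite leq_add2l conj_normC.
have -> : w * c * (w^-1 * c^-1) * g = c ^ w^-1 * (c^-1 * g).
  by rewrite conjgE invgK !mulgA.
apply: leq_trans (conj_normM _ _) _; rewrite conj_normJ addnC.
by rewrite [conj_norm (c^-1 * g)]conj_normC.
Qed.

(** The deletion leaves [c v c v^-1 c^-1], a conjugate of [c]. *)
Lemma twist_absorb : conj_norm (c * tau) <= 2 + conj_norm c.
Proof.
apply: leq_trans (twist_mul_right c) _.
by rewrite mulgV conj_norm1.
Qed.

End Deletion.
End Distance.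

Section Upper.
Variable n : nat.
Hypothesis n0 : 0 < n.

(** [O^-1 x_j E = (x_j ^ O) c], so that at odd levels too the twist is that of two
    conjugates of letters, each times the same factor. *)
Lemma level_twist_odd j t : odd j ->
  level_twist n j t = twist n (x_ j ^ tO t * tC t) (y_ j ^ tO t * tC t).
Proof.
by move=> oj; rewrite /level_twist oj /tC !conjgE !mulgA !mulgK.
Qed.

Lemma level_twist_even j t : ~~ odd j ->
  level_twist n j t = twist n (x_ j * tV t) (y_ j * tV t).
Proof. by move=> oj; rewrite /level_twist (negbTE oj). Qed.

Lemma towerV m :
  tV (tower n m.+1) = tV (tower n m) * level_twist n (2 * n - m) (tower n m).
Proof. by rewrite /=; case: ifP. Qed.

Lemma towerC m : tC (tower n m.+1) =
  if odd m then (level_twist n (2 * n - m) (tower n m))^-1 * tC (tower n m)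
  else tC (tower n m) * level_twist n (2 * n - m) (tower n m).
Proof. by rewrite /tC /=; case: ifP => _ /=; rewrite ?invgM !mulgA. Qed.

Lemma conj_norm_x g i : conj_norm (x_ i ^ g) <= 1.
Proof. by rewrite conj_normJ; apply: conj_norm_gen. Qed.

Lemma conj_norm_y g i : conj_norm (y_ i ^ g) <= 1.
Proof. by rewrite conj_normJ; apply: conj_norm_gen. Qed.

Lemma even_level_upper m : m < 2 * n -> ~~ odd m ->
  let t := tower n m in let s := tower n m.+1 in
  [/\ conj_norm (tV s) <= 2 + conj_norm (tV t),
      conj_norm (tC s) <= 2 + (conj_norm (tV t * tC t) + conj_norm (tV t)),
      conj_norm ((tC s)^-1 * tV s) <= conj_norm ((tC t)^-1 * tV t)
    & conj_norm (tV s * tC s) <= 4 + conj_norm (tV t * tC t)].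
Proof.
move=> ltm em; cbv zeta; rewrite towerC towerV (negbTE em).
have ej : ~~ odd (2 * n - m) by rewrite odd_level // ltnW.
rewrite level_twist_even //; move: (tC _) (tV _) => c V.
set tau := twist n _ _.
have [x1 y1] := (conj_norm_gen (2 * n - m, false), conj_norm_gen (2 * n - m, true)).
split.
- exact: twist_absorb.
- by rewrite [conj_norm (V * c)]conj_normC; apply: twist_mul_left.
- have -> : (c * tau)^-1 * (V * tau) = (c^-1 * V) ^ tau.
    by rewrite conjgE [in LHS]invgM !mulgA.
  by rewrite conj_normJ.
have -> : V * tau * (c * tau) = (tau * c * (tau * V)) ^ V^-1.
  by rewrite conjgE invgK !mulgA mulgK.
rewrite conj_normJ; apply: leq_trans (twist_pair_left _ n0 x1 y1 _ _) _.
by rewrite mulVg conj_norm1 addn0 leq_add2l conj_normC.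
Qed.

Lemma odd_level_upper m : m < 2 * n -> odd m ->
  let t := tower n m in let s := tower n m.+1 in
  [/\ conj_norm (tV s) <= 2 + (conj_norm ((tC t)^-1 * tV t) + conj_norm (tC t)),
      conj_norm ((tC s)^-1 * tV s) <= 4 + conj_norm ((tC t)^-1 * tV t),
      conj_norm (tV s * tC s) = conj_norm (tV t * tC t)
    & conj_norm (tV s ^+ 2) <=
        4 + (conj_norm (tV t * tC t) + conj_norm ((tC t)^-1 * tV t))].
Proof.
move=> ltm om; cbv zeta; rewrite towerC towerV om.
have oj : odd (2 * n - m) by rewrite odd_level // ltnW.
rewrite level_twist_odd //; move: (tO _) (tC _) (tV _) => O c V.
set tau := twist n _ _.
have [x1 y1] := (conj_norm_x O (2 * n - m), conj_norm_y O (2 * n - m)).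
split.
- by rewrite [conj_norm (c^-1 * V)]conj_normC; apply: twist_mul_right.
- have -> : (tau^-1 * c)^-1 * (V * tau) = (tau * V * (tau * c^-1)) ^ c.
    by rewrite invgM invgK conjgE !mulgA mulgVK.
  rewrite conj_normJ; apply: leq_trans (twist_pair_right _ n0 x1 y1 _ _) _.
  by rewrite mulVg conj_norm1 addn0.
- by rewrite (mulgA (V * tau)) mulgK.
have -> : (V * tau) ^+ 2 = (tau * V * (tau * V)) ^ V^-1.
  by rewrite expg2 conjgE invgK !mulgA mulgK.
by rewrite conj_normJ; apply: twist_pair_left.
Qed.

(** Over a pair of levels the norm of [V] grows by at most 4 plus the norms of
    [V c] and [c^-1 V], and each of these two grows by at most 4. *)
Lemma tower_upper a : a <= n ->
  let t := tower n (2 * a) in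
  [/\ conj_norm (tV t) <= 4 * a ^ 2, conj_norm ((tC t)^-1 * tV t) <= 4 * a
    & conj_norm (tV t * tC t) <= 4 * a].
Proof.
elim: a => [|a IHa] lea; cbv zeta.
  by rewrite muln0 /tC /= !(invg1, mul1g) conj_norm1.
have [] := IHa (ltnW lea).
have -> : (2 * a.+1)%N = (2 * a).+2 by lia.
have [||] := @even_level_upper (2 * a); [lia | by rewrite oddM |].
have [||] := @odd_level_upper (2 * a).+1; [lia | by rewrite oddS oddM |].
move: (tower n (2 * a).+2) (tower n (2 * a).+1) (tower n (2 * a)) => u s t.
move=> V2 A2 B2 _ V1 C1 A1 B1 V0 A0 B0; rewrite B2; split; [|lia|lia].
apply: leq_trans V2 _; apply: leq_trans (leq_add (leqnn 2) (leq_add A1 C1)) _.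
move: A0 B0 V0; set v := conj_norm (tV t); move: (conj_norm _) (conj_norm _) v.
by clear; move=> p q v; nia.
Qed.

Lemma g_upper : 1 < n -> conj_norm (g_ n) <= 4 * n ^ 2 - 8 * n + 5.
Proof.
move=> n1; rewrite g_tower //.
have -> : (2 * n - 2 = 2 * n.-1)%N by lia.
have [|V0 _ _] := tower_upper (a := n.-1); first exact: leq_pred.
apply: leq_trans (conj_normM _ _) _.
apply: leq_trans (leq_add (conj_norm_gen _) V0) _.
by move: n1; case: (n) => // k _ /=; nia.
Qed.

(** At the last odd level [V^2] splits into the two slowly growing words [V c] and
    [c^-1 V], so the quadratic growth of the norm of [V] is avoided. *)
Lemma g_square_upper : 1 < n -> conj_norm (g_ n ^+ 2) <= 8 * n - 4.
Proof.
move=> n1; rewrite g_tower //.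
have -> : (2 * n - 2 = (2 * n.-2).+2)%N by lia.
have [|_ A0 B0] := @tower_upper n.-2; first by lia.
have [||_ _ A1 B1] := @even_level_upper (2 * n.-2); [lia | by rewrite oddM |].
have [||_ _ _ V2] := @odd_level_upper (2 * n.-2).+1; [lia | by rewrite oddS oddM |].
have x1 : dist (x_ 0 * tV (tower n (2 * n.-2).+2)) (tV (tower n (2 * n.-2).+2)) <= 1.
  by rewrite /dist mulgK; apply: conj_norm_gen.
apply: leq_trans (conj_norm_dist_le (distM_le x1 x1)) _.
apply: leq_trans (leq_add (leqnn 2) V2) _.
apply: leq_trans (leq_add (leqnn 2) (leq_add (leqnn 4) (leq_add B1 A1))) _.
apply: leq_trans (leq_add (leqnn 2) (leq_add (leqnn 4)
  (leq_add (leq_add (leqnn 4) B0) A0))) _.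
by move: n1; clear; lia.
Qed.

End Upper.

(** * Lower bounds *)

Definition above (j : nat) (g : F_infty) : bool :=
  all (fun l : bool * (nat * bool) => j < l.2.1) (val g).

Lemma reduce_subset (T : choiceType) (w : seq (bool * T)) : {subset reduce w <= w}.
Proof.
elim: w => //= l w IHw k; rewrite -/(reduce w).
case: (reduce w) IHw => [_|a v IHw] /=; first by rewrite !inE => ->.
case: ifP => _ kv; last first.
  by move: kv; rewrite inE => /predU1P[->|/IHw kw]; rewrite inE ?eqxx // kw orbT.
by rewrite inE IHw ?orbT // inE kv orbT.
Qed.

Lemma above1 j : above j 1.
Proof. by []. Qed.

Lemma aboveM j g h : above j g -> above j h -> above j (g * h).
Proof.
move=> ag ah; apply/allP => l /reduce_subset; rewrite mem_cat.
by case/orP => [/(allP ag) | /(allP ah)].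
Qed.

Lemma aboveV j g : above j g -> above j g^-1.
Proof.
move=> ag; apply/allP => l; rewrite mem_rev => /mapP[k kg ->].
exact: (allP ag k kg).
Qed.

Lemma aboveX j g i : above j g -> above j (g ^+ i).
Proof. by move=> ag; elim: i => [|i IH] //; rewrite expgS aboveM. Qed.

Lemma above_gen j s : j < s.1 -> above j (free_gen s).
Proof. by move=> js; rewrite /above /= js. Qed.

Lemma above_le i j g : i <= j -> above j g -> above i g.
Proof. by move=> ij; apply: sub_all => l; apply: leq_ltn_trans. Qed.

Lemma above_avoids j g : above j g -> avoids j g.
Proof. by apply: sub_all => l; rewrite ltn_neqAle eq_sym => /andP[]. Qed.

Lemma above_tower n m : m <= 2 * n ->
  [/\ above (2 * n - m) (tV (tower n m)), above (2 * n - m) (tE (tower n m))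
    & above (2 * n - m) (tO (tower n m))].
Proof.
elim: m => [|m IHm] le; first by rewrite !above1.
have [aV aE aO] := IHm (ltnW le).
have lt : 2 * n - m.+1 < 2 * n - m by lia.
have {}aV := above_le (ltnW lt) aV; have {}aE := above_le (ltnW lt) aE.
have {}aO := above_le (ltnW lt) aO.
have ax : above (2 * n - m.+1) (x_ (2 * n - m)) by apply: above_gen.
have ay : above (2 * n - m.+1) (y_ (2 * n - m)) by apply: above_gen.
have a_tau : above (2 * n - m.+1) (level_twist n (2 * n - m) (tower n m)).
  by rewrite /level_twist /twist; case: ifP => _;
     do ![apply: aboveM | apply: aboveX | apply: aboveV].
by rewrite /=; case: ifP => _ /=; split=> //; apply: aboveM.
Qed.

Lemma above_tC n m : m <= 2 * n -> above (2 * n - m) (tC (tower n m)).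
Proof. by case/above_tower => _ aE aO; apply: aboveM => //; apply: aboveV. Qed.

Section Endomorphism.
Variables (T : choiceType) (f : T -> free_group T).

(** An endomorphism that maps the generators to conjugates of themselves does not
    increase the norm. *)
Lemma conj_norm_free_ext g :
  (forall t, exists h, f t = free_gen t ^ h) ->
  conj_norm (free_ext f g) <= conj_norm g.
Proof.
move=> fc; have [s [<- {1}->]] := conj_normP g; elim: s => [|p s IHs].
  by rewrite big_nil free_ext1 conj_norm1.
rewrite big_cons free_extM /= -add1n.
apply: leq_trans (conj_normM _ _) (leq_add _ IHs).
rewrite gmulfJ conj_normJ /free_letter.
have [h E] := fc p.1.2.
case: (p.1.1); first rewrite gmulfV; rewrite /= free_ext_gen E.
  by rewrite conj_normV conj_normJ conj_norm_gen.
by rewrite conj_normJ conj_norm_gen.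
Qed.

Lemma free_ext_fixed g :
  all (fun l => f l.2 == free_gen l.2) (val g) -> free_ext f g = g.
Proof.
move=> fx; rewrite [RHS]free_letterE; apply: eq_big_seq => l /(allP fx) /eqP E.
by rewrite /free_ext_letter /free_letter E.
Qed.

End Endomorphism.

Lemma eval_ext (G : groupType) (f f' : bool * bool -> G) w :
  all (predC is_xy) w -> (forall t, ~~ t.1 -> f t = f' t) ->
  eval f w = eval f' w.
Proof.
move=> nw ff'; apply: eq_big_seq => l lw; have nl := allP nw l lw.
by rewrite /free_ext_letter (ff' l.2 nl).
Qed.

Lemma gmulf_twist (G H : groupType) (h : UMagmaMorphism.type G H) n p q :
  h (twist n p q) = twist n (h p) (h q).
Proof. by rewrite /twist !(gmulfM, gmulfXn, gmulfV). Qed.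

Section Lower.
Variable n : nat.
Hypothesis n1 : 0 < n.

Definition stage (m : nat) (t : bool * bool) : F_infty :=
  if t.2 then tC (tower n m) else tV (tower n m).

Definition cost (m : nat) (w : seq symbol) : nat := conj_norm (eval (stage m) w).

(** Passing to the next level is a substitution in the words over [V] and [c].  At
    odd levels it produces the conjugates of the letters by [O]; as [O] only
    involves higher levels, an endomorphism undoes this conjugation. *)
Lemma cost_splits m u : m < 2 * n -> all (predC is_xy) u ->
  exists d rs, [/\ splits (subst (step n (odd m)) u) d rs,
    all (all (predC is_xy)) rs & d + \sum_(r <- rs) cost m r <= cost m.+1 u].
Proof.
move=> ltm nu; set j := (2 * n - m)%N.
have [aV _ aO] := above_tower (ltnW ltm); have aC := above_tC (ltnW ltm).
have [d [rs [sp le]]] := splits_of_norm (above_avoids aV) (above_avoids aC)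
   (subst (step n (odd m)) u).
have nrs := splits_regions sp.
exists d, rs; split=> //.
have -> : \sum_(r <- rs) cost m r =
    \sum_(r <- rs) conj_norm (eval (assign j (tV (tower n m)) (tC (tower n m))) r).
  apply: eq_big_seq => r /(allP nrs) nr; rewrite /cost; congr conj_norm.
  by apply: eval_ext => // -[[] b].
apply: leq_trans le _; rewrite eval_subst /cost.
pose O := tO (tower n m).
have stageV : stage m.+1 (false, false) =
    tV (tower n m) * level_twist n j (tower n m) by rewrite -towerV.
have stageC : stage m.+1 (false, true) =
    if odd m then (level_twist n j (tower n m))^-1 * tC (tower n m)
    else tC (tower n m) * level_twist n j (tower n m) by rewrite -towerC.
have oj : odd j = odd m by rewrite odd_level // ltnW.
case om: (odd m); rewrite om in stageC; last first.
  rewrite (eval_ext (f' := stage m.+1)) // => -[[] []] //= _;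
    rewrite eval_cons eval_twist_word /free_ext_letter ?stageC ?stageV;
    by rewrite level_twist_even ?oj ?om.
(* [f] conjugates the two letters of the level so as to cancel [O] *)
pose f (s : nat * bool) : F_infty :=
  if s.1 == j then free_gen s ^ O^-1 else free_gen s.
have fx g : above j g -> free_ext f g = g.
  move=> ag; apply: free_ext_fixed; apply/allP => l /(allP ag) lt.
  by rewrite /f gtn_eqF.
have fg b : free_ext f (free_gen (j, b) ^ O) = free_gen (j, b).
  by rewrite gmulfJ /= (fx O) // free_ext_gen /f eqxx -conjgM mulVg conjg1.
apply: leq_trans (conj_norm_free_ext (f := f) _ _); last first.
  by move=> t; rewrite /f; case: ifP => _; [exists O^-1 | exists 1; rewrite conjg1].
rewrite [X in _ <= conj_norm X](_ : _ = eval (fun t => free_ext f (stage m.+1 t)) u).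
  apply: eq_leq; congr conj_norm; apply: eval_ext => // -[[] b] // _.
  have tauE : free_ext f (level_twist n j (tower n m)) =
      twist n (free_gen (j, false) * tC (tower n m))
        (free_gen (j, true) * tC (tower n m)).
    rewrite level_twist_odd ?oj //.
    rewrite gmulf_twist /=; congr (twist n _ _).
      by rewrite free_extM (fg false) fx.
    by rewrite free_extM (fg true) fx.
  case: b; last first.
    by rewrite stageV eval_cons eval_twist_word gmulfM /= tauE (fx (tV _)).
  rewrite stageC eval_cat eval_inv eval_cons eval_nil mulg1 eval_twist_word.
  by rewrite gmulfM gmulfV /= tauE (fx (tC _)).
rewrite /eval gmulf_prod /=; apply: eq_bigr => l _.
by rewrite /free_ext_letter; case: ifP => _ //; rewrite gmulfV.
Qed.


Import GRing.Theory Num.Theory.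

Definition nontrivial (w : seq symbol) : bool :=
  (expo false w != 0)%R || (expo true w != 0)%R.

Lemma exists_nonzero (E : seq symbol -> int) (rs : seq (seq symbol)) :
  (\sum_(r <- rs) E r != 0)%R -> exists2 r, r \in rs & (E r != 0)%R.
Proof.
move=> ne; apply/hasP; apply: contraNT ne => /hasPn z.
by rewrite big_seq big1 // => r /z; rewrite negbK => /eqP.
Qed.

Lemma exists_odd (E : seq symbol -> int) (rs : seq (seq symbol)) :
  odd `|(\sum_(r <- rs) E r)%R|%N -> exists2 r, r \in rs & odd `|E r|%N.
Proof.
move=> od; apply/hasP; apply: contraTT od => /hasPn ev.
elim: rs ev => [|r rs IHrs] ev; first by rewrite big_nil.
rewrite big_cons; have := ev r (mem_head _ _).
have := IHrs (fun s srs => ev s (mem_behead (s := r :: rs) srs)).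
by move=> /= evs evr; lia.
Qed.

Lemma leq_region (N : seq symbol -> nat) r rs :
  r \in rs -> N r <= \sum_(s <- rs) N s.
Proof. by move=> rrs; rewrite (big_rem r rrs) leq_addr. Qed.

Lemma leq_two_regions (N : seq symbol -> nat) r1 r2 rs :
  r1 \in rs -> r2 \in rem r1 rs -> N r1 + N r2 <= \sum_(s <- rs) N s.
Proof. by move=> h1 h2; rewrite (big_rem r1 h1) leq_add2l; apply: leq_region. Qed.

Lemma splits_good o w d rs : all (predC is_xy) w -> good w ->
  splits (subst (step n o) w) d rs -> exists2 r, r \in rs & good r.
Proof.
move=> nw gw sw; apply: exists_odd.
by rewrite big_split /= !(splits_expo _ nw sw).
Qed.

Lemma splits_nontrivial o w d rs : all (predC is_xy) w -> nontrivial w ->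
  splits (subst (step n o) w) d rs -> exists2 r, r \in rs & nontrivial r.
Proof.
move=> nw /orP[] nz sw; rewrite -(splits_expo _ nw sw) in nz;
  have [r rrs nr] := exists_nonzero nz; exists r => //; apply/orP; by [left | right].
Qed.

Lemma odd_nontrivial s r : odd `|expo s r|%N -> nontrivial r.
Proof. by move=> o; apply/orP; case: s o => o; [right | left]; lia. Qed.

(** Since exponents add up, a region whose exponent differs in parity from that of
    the word forces another one with nonzero exponents. *)
Lemma splits_second s o w d rs r : all (predC is_xy) w ->
  splits (subst (step n o) w) d rs -> r \in rs ->
  odd `|(expo s w - expo s r)%R|%N -> exists2 r', r' \in rem r rs & nontrivial r'.
Proof.
move=> nw sw rrs; rewrite -(splits_expo s nw sw) (big_rem r rrs) /= addrC addrK.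
by case/exists_odd=> r' r'rs /odd_nontrivial; exists r'.
Qed.

(** The dichotomy behind the quadratic bound: either [4n] letters of the level are
    deleted, or the word splits off a region with odd exponent in [s] beside a
    good one.  If the good region itself has odd exponent in [s], a further one
    restores the parity. *)
Lemma splits_two s w d rs : all (predC is_xy) w -> good w ->
  ~~ odd `|expo s w|%N -> splits (subst (step n s) w) d rs ->
  4 * n <= d \/
  exists r1 r2, [/\ r1 \in rs, good r1, r2 \in rem r1 rs & nontrivial r2].
Proof.
move=> nw gw ew sw.
have [/hasP[r0 r0rs o0]|/hasPn ev] := boolP (has (fun r => odd `|expo s r|%N) rs);
  last by left; apply: splits_ge4n gw sw ev.
right; have [r1 r1rs g1] := splits_good nw gw sw.
have [o1|e1] := boolP (odd `|expo s r1|%N).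
  have [|r2 r2rs n2] := splits_second (s := s) nw sw r1rs; last by exists r1, r2.
  by move: ew o1; clear; lia.
exists r1, r0; split=> //; last exact: odd_nontrivial o0.
have := perm_mem (perm_to_rem r1rs) r0; rewrite r0rs inE.
by case: eqP o0 => [->|//]; rewrite (negbTE e1).
Qed.

(** Only the even level of a pair is crossed here; it costs two letters when the
    exponent of its twist is nonzero. *)
Lemma nontrivial_even_level a u : a < n ->
  (forall r, all (predC is_xy) r -> nontrivial r -> 2 * a <= cost (2 * a) r) ->
  all (predC is_xy) u ->
  (nontrivial u -> 2 * a <= cost (2 * a).+1 u) /\
  ((expo false u + expo true u != 0)%R -> 2 * a + 2 <= cost (2 * a).+1 u).
Proof.
move=> lt IH nu; have [|d [rs [sp nrs le]]] := cost_splits (m := 2 * a) _ nu.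
  by lia.
rewrite oddM /= in sp.
have main : nontrivial u -> d + 2 * a <= cost (2 * a).+1 u.
  move=> nz; have [r rrs nr] := splits_nontrivial nu nz sp.
  apply: leq_trans le; rewrite leq_add2l.
  by apply: leq_trans (leq_region _ rrs); apply: IH => //; apply: (allP nrs).
split=> [nz|ne]; first by apply: leq_trans (main nz); apply: leq_addl.
have nz : nontrivial u by apply/orP; move: ne; clear; lia.
have d2 := splits_ge2 n1 nu sp ne.
by apply: leq_trans (main nz); rewrite addnC leq_add2r.
Qed.

(** In a word with nonzero exponents the twists of one of any two consecutive
    levels have nonzero exponent, which costs two letters, and some region
    inherits nonzero exponents. *)
Lemma nontrivial_lower a u : a <= n -> all (predC is_xy) u -> nontrivial u ->
  2 * a <= cost (2 * a) u.
Proof.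
elim: a u => // a IHa u lea nu nz.
have IH r : all (predC is_xy) r -> nontrivial r -> 2 * a <= cost (2 * a) r.
  exact: IHa (ltnW lea).
have -> : (2 * a.+1)%N = (2 * a).+2 by lia.
have [|d [rs [sp nrs le]]] := cost_splits (m := (2 * a).+1) _ nu; first by lia.
rewrite oddS oddM /= in sp.
have [e0|ne] := eqVneq (expo false u) (expo true u).
  (* the odd twists cancel out, so the even ones do not *)
  have : (\sum_(r <- rs) (expo false r + expo true r) != 0)%R.
    rewrite big_split /= !(splits_expo _ nu sp); move: nz; rewrite /nontrivial e0.
    by clear; lia.
  case/exists_nonzero=> r rrs nr.
  have [_ /(_ nr) ler] := nontrivial_even_level lea IH (allP nrs r rrs).
  apply: leq_trans le; apply: leq_trans (leq_addl _ _).
  apply: leq_trans (leq_region _ rrs); apply: leq_trans ler.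
  by rewrite addn2.
have d2 := splits_ge2 n1 nu sp ne.
have [r rrs nr] := splits_nontrivial nu nz sp.
have [/(_ nr) ler _] := nontrivial_even_level lea IH (allP nrs r rrs).
apply: leq_trans le; rewrite -add2n; apply: leq_add d2 _.
exact: leq_trans ler (leq_region _ rrs).
Qed.

(** At an even level the letters carry the factor [V], so the stronger bound holds
    for good words with even exponent in [V]. *)
Lemma good_even_level a u : a < n ->
  (forall r, all (predC is_xy) r -> good r -> a * a.+1 <= cost (2 * a) r) ->
  all (predC is_xy) u -> good u ->
  a * a.+1 + 2 <= cost (2 * a).+1 u /\
  (~~ odd `|expo false u|%N -> a * a.+1 + 2 * a + 2 <= cost (2 * a).+1 u).
Proof.
move=> lt IH nu gu; have [|d [rs [sp nrs le]]] := cost_splits (m := 2 * a) _ nu.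
  by lia.
rewrite oddM /= in sp.
have ne : (expo false u + expo true u != 0)%R.
  by move: gu; rewrite /good; clear; lia.
have d2 := splits_ge2 n1 nu sp ne.
have [r rrs gr] := splits_good nu gu sp.
have ler := leq_trans (IH r (allP nrs r rrs) gr) (leq_region (cost (2 * a)) rrs).
split=> [|ev].
  by apply: leq_trans le; rewrite addnC; apply: leq_add.
have [d4|[r1 [r2 [h1 g1 h2 nz2]]]] := splits_two nu gu ev sp.
  apply: leq_trans le; apply: leq_trans (leq_add d4 ler).
  by move: lt; clear; lia.
have nr2 : all (predC is_xy) r2 := allP nrs r2 (mem_rem h2).
have := leq_trans (leq_add (IH r1 (allP nrs r1 h1) g1)
  (nontrivial_lower (ltnW lt) nr2 nz2)) (leq_two_regions (cost (2 * a)) h1 h2).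
move=> le12; apply: leq_trans le; apply: leq_trans (leq_add d2 le12).
by rewrite addnC.
Qed.

(** A good word has odd exponent in exactly one of [V] and [c].  If this is [V], it
    must split at the odd level or lose [4n] letters there.  If it is [c], either
    a good region of the same kind arises, to which the same applies at the even
    level, or the change of kind already forces a second region. *)
Lemma good_lower a u : a <= n -> all (predC is_xy) u -> good u ->
  a * a.+1 <= cost (2 * a) u.
Proof.
elim: a u => // a IHa u lea nu gu.
have IH r : all (predC is_xy) r -> good r -> a * a.+1 <= cost (2 * a) r.
  exact: IHa (ltnW lea).
have IHn r : all (predC is_xy) r -> nontrivial r -> 2 * a <= cost (2 * a) r.
  exact: nontrivial_lower (ltnW lea).
have -> : (2 * a.+1)%N = (2 * a).+2 by lia.
have tE : (a.+1 * a.+2 = a * a.+1 + 2 * a + 2)%N by lia.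
have [|d [rs [sp nrs le]]] := cost_splits (m := (2 * a).+1) _ nu; first by lia.
rewrite oddS oddM /= in sp.
have ne : expo false u != expo true u.
  by move: gu; rewrite /good; clear; lia.
have d2 := splits_ge2 n1 nu sp ne.
have good1 r : r \in rs -> good r -> a * a.+1 + 2 <= cost (2 * a).+1 r.
  by move=> rrs gr; have [] := good_even_level lea IH (allP nrs r rrs) gr.
have nontriv1 r : r \in rs -> nontrivial r -> 2 * a <= cost (2 * a).+1 r.
  by move=> rrs nr; have [/(_ nr)] := nontrivial_even_level lea IHn (allP nrs r rrs).
have two r1 r2 : r1 \in rs -> good r1 -> r2 \in rem r1 rs -> nontrivial r2 ->
    a.+1 * a.+2 <= cost (2 * a).+2 u.
  move=> h1 g1 h2 nz2; apply: leq_trans le; apply: leq_trans (leq_add d2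
    (leq_trans (leq_add (good1 r1 h1 g1) (nontriv1 r2 (mem_rem h2) nz2))
      (leq_two_regions (cost (2 * a).+1) h1 h2))).
  by rewrite tE; clear; lia.
have [ev|od] := boolP (odd `|expo true u|%N); last first.
  have [d4|[r1 [r2 [h1 g1 h2 nz2]]]] := splits_two nu gu od sp;
    last exact: two h1 g1 h2 nz2.
  have [r rrs gr] := splits_good nu gu sp.
  apply: leq_trans le; apply: leq_trans (leq_add d4
    (leq_trans (good1 r rrs gr) (leq_region (cost (2 * a).+1) rrs))).
  by rewrite tE; move: lea; clear; lia.
have [r rrs gr] := splits_good nu gu sp.
have [er|or] := boolP (odd `|expo false r|%N); last first.
  have [_ /(_ or) ler] := good_even_level lea IH (allP nrs r rrs) gr.
  apply: leq_trans le; apply: leq_trans (leq_addl _ _).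
  by rewrite tE; apply: leq_trans ler (leq_region _ rrs).
have [|r2 h2 nz2] := splits_second (s := true) nu sp rrs.
  by move: ev er gr; rewrite /good; clear; lia.
exact: two rrs gr h2 nz2.
Qed.

(** The letter [x_0] plays the role of [x] at a last level, where the word is
    [x V] or its square. *)
Section Bottom.
Hypothesis n2 : 1 < n.
Let m := (2 * n.-1)%N.
Let V := tV (tower n m).

Lemma bottom_splits w : exists d rs, [/\ splits w d rs,
  all (all (predC is_xy)) rs &
  d + \sum_(r <- rs) cost m r <= conj_norm (eval (assign 0 V (tC (tower n m))) w)].
Proof.
have mle : m <= 2 * n by rewrite /m; lia.
have [aV _ _] := above_tower mle; have aC := above_tC mle.
have [d [rs [sp le]]] := splits_of_norm (above_avoids (above_le (leq0n _) aV))
  (above_avoids (above_le (leq0n _) aC)) w.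
have nrs := splits_regions sp.
exists d, rs; split=> //.
have <- : \sum_(r <- rs) conj_norm (eval (assign 0 V (tC (tower n m))) r) =
    \sum_(r <- rs) cost m r.
  apply: eq_big_seq => r /(allP nrs) nr; rewrite /cost; congr conj_norm.
  by apply: eval_ext => // -[[] b].
exact: le.
Qed.

Lemma g_bottom : g_ n = x_ 0 * V.
Proof. by rewrite g_tower // /V /m; congr (_ * tV (tower _ _)); lia. Qed.

Lemma sum_expo b w d rs : splits w d rs -> (\sum_(r <- rs) expo b r)%R = expo b w.
Proof. by move=> sp; rewrite /expo -(splits_weight _ sp). Qed.

Lemma g_lower : n ^ 2 - n + 1 <= conj_norm (g_ n).
Proof.
have [d [rs [sp nrs]]] := bottom_splits [:: sym_x; sym false].
rewrite !eval_cons eval_nil mulg1 -[X in conj_norm X]g_bottom => le.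
have d1 : 0 < d by have := splits_parity sp; case: d {sp le}.
have : odd `|(\sum_(r <- rs) (expo false r + expo true r))%R|%N.
  by rewrite big_split /= !(sum_expo _ sp) /expo !weight_cons !weight_nil.
case/exists_odd=> r rrs gr.
have ler := good_lower (leq_pred n) (allP nrs r rrs) gr.
apply: leq_trans le.
apply: leq_trans (leq_add d1 (leq_trans ler (leq_region (cost m) rrs))).
by rewrite prednK // -mulnn; move: n2; clear; nia.
Qed.

Lemma g_square_lower : 2 * n <= conj_norm (g_ n ^+ 2).
Proof.
have [d [rs [sp nrs]]] := bottom_splits [:: sym_x; sym false; sym_x; sym false].
rewrite !eval_cons eval_nil mulg1 mulgA -[X in conj_norm X]/((x_ 0 * V) * (x_ 0 * V)).
rewrite -g_bottom -expg2 => le.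
have d2 : 1 < d.
  have := splits_parity sp; case: d sp {le} => [|[|d]] // sp _.
  pose act (l : symbol) (z : int) : int :=
    (if is_xy l then (if l.1 then z - 1 else z + 1) else z)%R.
  have actK l z : act l (act (letter_inv l) z) = z.
    by rewrite /act; case: l => [[] [[] b]] /=; rewrite ?subrK ?addrK.
  have rid r : r \in rs -> run act r =1 id.
    move=> rrs; have := allP nrs r rrs; elim: r {rrs} => // l r IHr.
    by case/andP=> /negbTE nl /IHr{}IHr z; rewrite run_cons IHr /act nl.
  by have := run_splits_id actK sp erefl rid 0.
have : (\sum_(r <- rs) expo false r != 0)%R.
  by rewrite (sum_expo _ sp) /expo !weight_cons !weight_nil.
case/exists_nonzero=> r rrs nr.
have nz : nontrivial r by rewrite /nontrivial nr.
have ler := nontrivial_lower (leq_pred n) (allP nrs r rrs) nz.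
apply: leq_trans le.
apply: leq_trans (leq_add d2 (leq_trans ler (leq_region (cost m) rrs))).
by move: n2; clear; lia.
Qed.

End Bottom.
End Lower.

Local Close Scope group_scope.

Theorem theorem3p1 (n : nat) (hn : 2 <= n) :
  [/\ generated (mem (gens_upto (2 * n))) (g_ n),
      n ^ 2 - n + 1 <= conj_norm (g_ n) <= 4 * n ^ 2 - 8 * n + 5
    & 2 * n <= conj_norm (g_ n ^+ 2)%g <= 8 * n - 4].
Proof.
have n_gt0 : 0 < n by exact: ltnW.
split; first exact: g_generated.
  by rewrite g_lower // g_upper.
by rewrite g_square_lower // g_square_upper.
Qed.
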